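(* Let $A<\mathbb{R}$ be a subring with $A\neq\mathbb{Z}$. Then the group $H(A)$ is non-amenable.
   Context: Let $\mathbb{P}^1=\mathbb{P}^1(\mathbb{R})$ be the real projective line with its usual (real) topology, a topological circle, on which $\mathrm{PSL}_2(\mathbb{R})$ acts naturally by projective (Möbius) transformations. Let $G$ be the group of all homeomorphisms of $\mathbb{P}^1$ which are piecewise in $\mathrm{PSL}_2(\mathbb{R})$, i.e. there are finitely many intervals of $\mathbb{P}^1$ covering it such that on each interval the homeomorphism agrees with an element of $\mathrm{PSL}_2(\mathbb{R})$. Let $\infty\in\mathbb{P}^1$ be the point corresponding to the first basis vector of $\mathbb{R}^2$, and let $H<G$ be the stabilizer of $\infty$. For a subring $A<\mathbb{R}$, let $P_A\subseteq\mathbb{P}^1$ be the set of all fixed points of all hyperbolic elements (those with $|\mathrm{trace}|>2$) of $\mathrm{PSL}_2(A)$. Let $G(A)<G$ be the subgroup of elements that are piecewise in $\mathrm{PSL}_2(A)$ with all interval endpoints (breakpoints) in $P_A$, and $H(A)=G(A)\cap H$. *)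

(* Defs.v *)
From Stdlib Require Import Reals List.
Open Scope R_scope.

Definition is_subring (A : R -> Prop) : Prop :=
  A 0 /\ A 1 /\ (forall x y, A x -> A y -> A (x + y)) /\
  (forall x, A x -> A (- x)) /\ (forall x y, A x -> A y -> A (x * y)).

(** The real projective line: [None] is infinity = [1:0] (first basis
    vector), [Some x] is the line [x:1]. *)
Definition P1 := option R.

Record mat := Mat { ma : R; mb : R; mc : R; md : R }.
Definition det (m : mat) : R := ma m * md m - mb m * mc m.

(** Projective action: [x:y] |-> [a x + b y : c x + d y]. *)
Definition mob (m : mat) (p : P1) : P1 :=
  match p with
  | None => if Req_EM_T (mc m) 0 then None else Some (ma m / mc m)
  | Some x =>
      if Req_EM_T (mc m * x + md m) 0 then None
      else Some ((ma m * x + mb m) / (mc m * x + md m))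
  end.

(** Representatives of PSL_2(R) resp. PSL_2(A): determinant-one matrices
    (the action only depends on the class modulo +-1). *)
Definition SL2R (m : mat) : Prop := det m = 1.
Definition SL2 (A : R -> Prop) (m : mat) : Prop :=
  A (ma m) /\ A (mb m) /\ A (mc m) /\ A (md m) /\ det m = 1.

Definition hyperbolic (m : mat) : Prop := Rabs (ma m + md m) > 2.

Definition P_A (A : R -> Prop) (p : P1) : Prop :=
  exists m, SL2 A m /\ hyperbolic m /\ mob m p = p.

(** Chordal metric on P^1 (sine of the angle between the lines),
    inducing the usual topology. *)
Definition pdist (p q : P1) : R :=
  match p, q with
  | Some x, Some y => Rabs (x - y) / (sqrt (1 + x ^ 2) * sqrt (1 + y ^ 2))
  | Some x, None => 1 / sqrt (1 + x ^ 2)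
  | None, Some y => 1 / sqrt (1 + y ^ 2)
  | None, None => 0
  end.

Definition pcontinuous (f : P1 -> P1) : Prop :=
  forall p eps, 0 < eps -> exists delta, 0 < delta /\
    forall q, pdist p q < delta -> pdist (f p) (f q) < eps.

Definition homeomorphism (f : P1 -> P1) : Prop :=
  exists g : P1 -> P1, (forall p, g (f p) = p) /\ (forall p, f (g p) = p) /\
    pcontinuous f /\ pcontinuous g.

(** Cyclic order: going through R increasingly, then infinity. *)
Definition plt (p q : P1) : Prop :=
  match p, q with
  | Some x, Some y => x < y
  | Some _, None => True
  | None, _ => False
  end.
Definition ple (p q : P1) : Prop := plt p q \/ p = q.

(** Closed arc from p to q in the positive direction (for p <> q). *)
Definition in_arc (p q x : P1) : Prop :=
  (plt p q /\ ple p x /\ ple x q) \/ (plt q p /\ (ple p x \/ ple x q)).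

(** g is piecewise in S with all breakpoints (interval endpoints) in B:
    either g agrees globally with an element of S (a single interval, no
    endpoints), or finitely many closed arcs cover P^1, each with endpoints
    in B, and on each arc g agrees with an element of S. *)
Definition piecewise_in (S : mat -> Prop) (B : P1 -> Prop) (g : P1 -> P1)
  : Prop :=
  (exists m, S m /\ forall x, g x = mob m x) \/
  (exists pieces : list (P1 * P1 * mat),
     (forall x, exists pc, In pc pieces /\ in_arc (fst (fst pc)) (snd (fst pc)) x) /\
     (forall p q m, In (p, q, m) pieces ->
        p <> q /\ B p /\ B q /\ S m /\ forall x, in_arc p q x -> g x = mob m x)).

Definition inG (g : P1 -> P1) : Prop :=
  homeomorphism g /\ piecewise_in SL2R (fun _ => True) g.

Definition inG_A (A : R -> Prop) (g : P1 -> P1) : Prop :=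
  homeomorphism g /\ piecewise_in (SL2 A) (P_A A) g.

Definition inH_A (A : R -> Prop) (g : P1 -> P1) : Prop :=
  inG_A A g /\ g None = None.

Definition amenable {X : Type} (Gam : (X -> X) -> Prop) : Prop :=
  exists m : ((X -> X) -> Prop) -> R,
    m Gam = 1 /\
    (forall E, (forall k, E k -> Gam k) -> 0 <= m E) /\
    (forall E F, (forall k, E k -> Gam k) -> (forall k, F k -> Gam k) ->
       (forall k, E k -> F k -> False) ->
       m (fun k => E k \/ F k) = m E + m F) /\
    (forall g E, Gam g -> (forall k, E k -> Gam k) ->
       m (fun k => exists h, E h /\ k = (fun x => g (h x))) = m E).

(* Main.v *)
(** An invariant mean on H(A) would make the action of PSL_2(A) on the line
    amenable, so it suffices to exhibit elements of SL_2(A) that are both free and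
    close to the identity: close elements almost preserve Lebesgue measure on
    [0,1], whereas free ones admit a paradoxical decomposition.

    For h in H(A) and x in [0,1) consider the right germ at x of h^-1, a Moebius
    map over A. If a, b in SL_2(A) are free, their right translates act freely on
    Moebius maps, so there are disjoint sets W_l, one for each l in
    {a, a^-1, b, b^-1}, such that every f is in W_l or has f l in W_(l^-1). Let
    F_l(h) be the length of the set of those x in [0,1] whose germ is in W_l. The
    four lengths add up to at most 1. Some g in H(A) agrees with l^-1 on [0,1],
    so that the germ of (g h)^-1 at l^-1 x is that of h^-1 at x composed with l;
    for l close to the identity this yields F_l(h) + 1.1 F_(l^-1)(g h) >= 0.89.
    Averaging over h for l = a and l = b gives 1.78 <= 1.1.

    As A <> Z there is t in A with 0 < |t| < 1. Put s = t^n and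
    a = u(s) v(s) u(-s^2), b = u(s^3) v(s) u(-s^4), with u, v the upper and lower
    unipotents. A nontrivial word in a, b has as lower left entry y(s) where y is,
    up to sign, a monic integer polynomial all of whose complex roots have modulus
    at most 3. If y(t^n) = 0, then by Gauss's lemma the minimal polynomial P of t
    is monic and integral with all roots of modulus at most 3^(1/n), whence
    |P(0)|^n <= |t|^n 3^(deg P) < 1 for large n and P(0) = 0, a contradiction. *)

From mathcomp Require all_boot all_order all_algebra complex reals Rstruct.
Require Import Defs.
From Stdlib Require Import Reals ZArith.
From Stdlib Require Import List Lra Lia Classical ClassicalEpsilon.
From Stdlib Require Import FunctionalExtensionality PropExtensionality ProofIrrelevance.
From Coquelicot Require Import Coquelicot.
Import ListNotations.
Open Scope R_scope.

(** * Letters, reduced words and the recursion for the first column of their matrices *)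

(** The first component selects the generator, [true] for a and [false] for b; the second is [false]
    for its inverse. *)
Definition letter := (bool * bool)%type.
Definition linv (l : letter) : letter := (fst l, negb (snd l)).
Fixpoint reduced (w : list letter) : Prop :=
  match w with
  | nil => True
  | l :: w' =>
      match w' with nil => True | l' :: _ => l' <> linv l end /\ reduced w'
  end.

(** The letter [l] stands for [u(s^i) v(q) u(-s^j)] with [i = head_exp l], [j = head_exp (linv l)]
    and [q] equal to [s] or [-s]. Between consecutive letters [l], [l'] the unipotents merge into a
    shift by [s^(head_exp l') - s^(head_exp (linv l))], and the four exponents differ so that only a
    cancelling pair makes this vanish identically. *)
Definition head_exp (l : letter) : nat :=
  match l with
  | (true, true) => 1 | (true, false) => 2
  | (false, true) => 3 | (false, false) => 4
  end.
Arguments head_exp : simpl never.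

Definition head_shift (s : R) (w : list letter) : R :=
  match w with nil => 0 | l :: _ => s ^ head_exp l end.

(* If [word_vec s w = (p, y)] then the matrix of the word [w] has first column
   [(p + head_shift s w * y, y)]. *)
Fixpoint word_vec (s : R) (w : list letter) : R * R :=
  match w with
  | nil => (1, 0)
  | l :: w' =>
      let v := word_vec s w' in
      let p := fst v + (head_shift s w' - s ^ head_exp (linv l)) * snd v in
      (p, snd v + (if snd l then s else - s) * p)
  end.

Module WordPolynomials.
Import all_boot all_order all_algebra complex reals Rstruct.
Import Order.TTheory GRing.Theory Num.Theory.
Set Implicit Arguments. Unset Strict Implicit. Unset Printing Implicit Defensive.
Local Open Scope ring_scope.

(** * Integer polynomials without small power roots *)

Section IntegerPolynomialRoots.
Variable C : numClosedFieldType.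
Local Notation pC := (map_poly (intr : int -> C)).
Local Notation pQ := (map_poly (intr : int -> rat)).

Lemma pC_eq0 (P : {poly int}) : (pC P == 0) = (P == 0).
Proof. by rewrite -!size_poly_eq0 size_map_inj_poly //; apply: intr_inj. Qed.

Lemma ratr_pQ (P : {poly int}) : map_poly (ratr : rat -> C) (pQ P) = pC P.
Proof. by rewrite -map_poly_comp; apply: eq_map_poly => z; rewrite /= ratr_int. Qed.

Lemma exists_min_poly (t : C) (P : {poly int}) : P != 0 -> root (pC P) t ->
  exists P0 : {poly int}, [/\ P0 != 0, root (pC P0) t &
    forall Q : {poly int}, root (pC Q) t -> (size Q < size P0)%N -> Q = 0].
Proof.
have [n] := ubnP (size P); elim: n P => // n IHn P szP nzP rP.
case: (classic (exists Q : {poly int},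
   [/\ root (pC Q) t, (size Q < size P)%N & Q != 0])) => [[Q [rQ szQ nzQ]]|noQ].
  by apply: (IHn Q) => //; apply: leq_trans szQ _.
exists P; split => // Q rQ szQ; apply/eqP; apply: contraT => nzQ.
by case: noQ; exists Q.
Qed.

(** Divide over the rationals: the remainder vanishes at [t], and clearing its denominators yields
    an integer polynomial smaller than [P], which minimality forces to be zero. *)
Lemma min_poly_dvd (t : C) (P E : {poly int}) : P != 0 -> root (pC P) t ->
  (forall Q : {poly int}, root (pC Q) t -> (size Q < size P)%N -> Q = 0) ->
  root (pC E) t -> pQ P %| pQ E.
Proof.
move=> nzP rP minP rE; set r := pQ E %% pQ P.
have nzQ : pQ P != 0 by rewrite -size_poly_eq0 size_rat_int_poly size_poly_eq0.
have szr : (size r < size P)%N.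
  by rewrite -(size_rat_int_poly P) ltn_modp.
have rr : root (map_poly ratr r) t.
  have := rE; rewrite -ratr_pQ (divp_eq (pQ E) (pQ P)) rmorphD rmorphM /=.
  by rewrite /root hornerD hornerM !ratr_pQ (rootP rP) mulr0 add0r.
have [q [a nz_a Dr]] := rat_poly_scale r.
have Dr' : pQ q = a%:~R *: r by rewrite Dr scalerKV // intr_eq0.
have rq : root (pC q) t.
  by rewrite -ratr_pQ Dr' linearZ /root hornerZ (rootP rr) mulr0.
have szq : (size q < size P)%N.
  by rewrite -(size_rat_int_poly q) Dr' size_scale ?intr_eq0.
by rewrite /dvdp -/r Dr (minP q rq szq) map_poly0 scaler0.
Qed.

Lemma prod_normX_le (B : C) (n : nat) (s : seq C) :
  1 <= B -> (forall r, r \in s -> `|r| ^+ n <= B) ->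
  \prod_(r <- s) `|r| ^+ n <= B ^+ size s.
Proof.
move=> B1; elim: s => [|r s IHs] bound; first by rewrite big_nil expr0.
rewrite big_cons exprS; apply: ler_pM.
- by rewrite exprn_ge0.
- by apply: prodr_ge0 => i _; rewrite exprn_ge0.
- by apply: bound; rewrite mem_head.
by apply: IHs => i i_s; apply: bound; rewrite inE i_s orbT.
Qed.

Lemma small_power_not_root (t B : C) :
  t != 0 -> 1 <= B ->
  (forall d : nat, exists N : nat, forall n, (N <= n)%N -> `|t| ^+ n * B ^+ d < 1) ->
  exists N : nat, forall n, (N <= n)%N -> forall E : {poly int},
    `|lead_coef E| = 1 -> (forall r, root (pC E) r -> `|r| <= B) ->
    ~~ root (pC E) (t ^+ n).
Proof.
move=> nzt B1 small.
(* If [t] is transcendental, [E] composed with ['X^n] would be a nonzero integer polynomial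
   vanishing at [t]. *)
case: (classic (exists P : {poly int}, P != 0 /\ root (pC P) t)); last first.
  move=> noP; exists 1%N => n n_gt0 E lE _; apply/negP => rE.
  apply: noP; exists (E \Po 'X^n); split; last first.
    by rewrite map_comp_poly map_polyXn /root horner_comp hornerXn.
  rewrite -lead_coef_eq0 lead_coef_comp; last by rewrite size_polyXn.
  rewrite lead_coefXn expr1n mulr1; apply/eqP => l0.
  by move: lE; rewrite l0 normr0 => /eqP; rewrite eq_sym oner_eq0.
case=> P [nzP rP]; have [{}P [{}nzP {}rP minP]] := exists_min_poly nzP rP.
have [N HN] := small (size P); exists N.+1 => n lt_Nn E lE rootsE; apply/negP => rE.
have n_gt0 : (0 < n)%N by apply: leq_ltn_trans lt_Nn.
set F := E \Po 'X^n.
have lF : `|lead_coef F| = 1.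
  by rewrite lead_coef_comp ?size_polyXn // lead_coefXn expr1n mulr1.
have evF x : (pC F).[x] = (pC E).[x ^+ n].
  by rewrite map_comp_poly map_polyXn horner_comp hornerXn.
have rF : root (pC F) t by rewrite /root evF.
(* Gauss's lemma: a rational multiple [P1] of [P] divides [F] over the integers, so its leading
   coefficient divides one of absolute value 1. *)
have [P1 [a nz_a DP] [Q DF]] := dvdpP_rat_int (min_poly_dvd nzP rP minP rF).
have szP1 : size P1 = size P.
  by rewrite -(size_rat_int_poly P) DP size_scale // size_rat_int_poly.
have rP1 : root (pC P1) t.
  have := rP; rewrite -ratr_pQ DP linearZ /= /root hornerZ mulf_eq0 fmorph_eq0.
  by rewrite (negbTE nz_a) ratr_pQ.
have lP1 : `|lead_coef P1| = 1.
  have := lF; rewrite DF lead_coefM normrM => /eqP.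
  rewrite -!abszE -PoszM eqz_nat muln_eq1 => /andP[/eqP h _].
  by rewrite h.
have [rs Drs] := closed_field_poly_normal (pC P1).
have lP1C : `|lead_coef (pC P1)| = 1.
  rewrite lead_coef_map_id0 ?intr_eq0 ?lead_coef_eq0 //; last first.
    by rewrite -size_poly_eq0 szP1 size_poly_eq0.
  by rewrite -intr_norm lP1.
have nzP1 : pC P1 != 0.
  by rewrite -lead_coef_eq0 -normr_eq0 lP1C oner_eq0.
have rsE r : (r \in rs) = root (pC P1) r.
  rewrite Drs rootZ ?root_prod_XsubC // -normr_eq0 lP1C oner_eq0 //.
have t_rs : t \in rs by rewrite rsE.
(* A root [r] of [P1] is a root of [F], so [r ^+ n] is a root of [E]. *)
have bound r : r \in rs -> `|r| ^+ n <= B.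
  rewrite rsE => rr; rewrite -normrX; apply: rootsE.
  by rewrite /root -evF DF rmorphM hornerM (rootP rr) mul0r.
have size_rs : (size rs < size P)%N.
  rewrite -szP1 -(size_map_inj_poly (f := (intr : int -> C))) //; last exact: intr_inj.
  by rewrite Drs size_scale ?size_prod_XsubC // -normr_eq0 lP1C oner_eq0.
(* Up to sign the constant term is the product of the roots. The root [t] contributes its small
   [n]-th power, and each of the fewer than [size P] others at most [B]. *)
have val0 : `|(pC P1).[0]| ^+ n < 1.
  rewrite Drs hornerZ normrM lP1C mul1r horner_prod normr_prod.
  under eq_bigr => r _ do rewrite hornerXsubC sub0r normrN.
  rewrite -prodrXl (big_rem t) //=.
  apply: le_lt_trans (HN n (ltnW lt_Nn)).
  apply: ler_wpM2l; first by rewrite exprn_ge0.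
  apply: le_trans (prod_normX_le B1 _) _.
    by move=> r /mem_rem; apply: bound.
  apply: ler_weXn2l => //.
  apply: leq_trans (ltnW size_rs).
  by rewrite size_rem // leq_pred.
(* An integer of absolute value below 1 is zero. Then ['X] divides [P1], and the cofactor still
   vanishes at the nonzero [t], against minimality. *)
have P10 : P1.[0] = 0.
  move: val0; rewrite -(rmorph0 (intr : int -> C)) horner_map /=.
  rewrite -intr_norm -rmorphXn /= -[1]/(1%:~R) ltr_int => lt1.
  have /eqP : `|P1.[0]| ^+ n = 0.
    by apply/eqP; rewrite eq_le exprn_ge0 // andbT -ltzD1 add0r.
  by rewrite expf_eq0 n_gt0 /= normr_eq0 => /eqP.
have [q Dq] := factor_theorem _ _ (introT rootP P10).
rewrite subr0 in Dq.
have rq : root (pC q) t.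
  have := rP1; rewrite Dq rmorphM /= map_polyX /root hornerM hornerX mulf_eq0.
  by rewrite (negbTE nzt) orbF.
have nzq : q != 0.
  by apply/eqP => q0; move: nzP1; rewrite pC_eq0 Dq q0 mul0r eqxx.
have szq : (size q < size P)%N by rewrite -szP1 Dq size_mulX.
by move: nzq; rewrite (minP q rq szq) eqxx.
Qed.
End IntegerPolynomialRoots.

(** * Word polynomials *)

Section Words.
Variables (T : comNzRingType) (s : T).

Definition ring_head_shift (w : seq letter) : T :=
  if w is l :: _ then s ^+ head_exp l else 0.

(** The recursion of [word_vec] over any commutative ring, so that the same word can be read as an
    integer polynomial, a complex number or a real number. *)
Fixpoint ring_word_vec (w : seq letter) : T * T :=
  if w is l :: w' then
    let v := ring_word_vec w' in
    let p := v.1 + (ring_head_shift w' - s ^+ head_exp (linv l)) * v.2 in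
    (p, v.2 + (if l.2 then s else - s) * p)
  else (1, 0).
End Words.

Lemma ring_word_vec_morph (T U : comNzRingType) (f : {rmorphism T -> U}) (s : T) w :
  ring_word_vec (f s) w = (f (ring_word_vec s w).1, f (ring_word_vec s w).2).
Proof.
elim: w => [|l w IHw] /=; first by rewrite rmorph0 rmorph1.
have -> : ring_head_shift (f s) w = f (ring_head_shift s w).
  by case: w {IHw} => [|l' w] /=; rewrite ?rmorph0 ?rmorphXn.
have -> : (if l.2 then f s else - f s) = f (if l.2 then s else - s).
  by case: l.2; rewrite ?rmorphN.
by rewrite IHw /= !(rmorphD, rmorphM, rmorphN, rmorphXn).
Qed.

Lemma head_exp_gt0 l : (0 < head_exp l)%N. Proof. by case: l => [[] []]. Qed.

Lemma head_exp_inj : injective head_exp.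
Proof. by case=> [[] []] [[] []]. Qed.

(** Since [a] has positive degree, [a * b] has larger degree than [b] and hence than [c], so adding
    [c] leaves its leading term alone. *)
Lemma lead_coef_step (a b c : {poly int}) :
  `|lead_coef a| = 1 -> (1 < size a)%N -> `|lead_coef b| = 1 ->
  (size c <= size b)%N ->
  `|lead_coef (c + a * b)| = 1 /\ (size b < size (c + a * b)%R)%N.
Proof.
move=> la sza lb szc.
have nz (d : {poly int}) : `|lead_coef d| = 1 -> d != 0.
  by move=> ld; rewrite -lead_coef_eq0 -normr_eq0 ld.
have szab : (size b < size (a * b)%R)%N.
  rewrite size_mul ?nz // -subn1 -addnBAC ?(ltnW sza) // -[ltnLHS]add0n.
  by rewrite ltn_add2r subn_gt0.
have szcab : (size c < size (a * b)%R)%N by apply: leq_ltn_trans szc szab.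
by rewrite addrC lead_coefDl // size_polyDl // lead_coefM normrM la lb.
Qed.

Lemma lead_coef_subXn i j : (0 < i)%N -> (0 < j)%N -> i != j ->
  `|lead_coef ('X^i - 'X^j : {poly int})| = 1 /\
  (1 < size ('X^i - 'X^j : {poly int})%R)%N.
Proof.
wlog lt_ij : i j / (i < j)%N.
  move=> H i0 j0; rewrite neq_ltn => /orP[ij|ji].
    by apply: H => //; rewrite neq_ltn ij.
  have := H j i ji j0 i0; rewrite neq_ltn ji -opprB lead_coefN normrN size_polyN.
  by apply.
move=> i0 j0 _.
rewrite addrC lead_coefDl ?size_polyDl ?size_polyN ?size_polyXn //.
by rewrite lead_coefN lead_coefXn normrN normr1.
Qed.

(** Each letter applies [lead_coef_step] twice, first with a difference of two distinct powers of
    ['X], distinct because the word is reduced, then with ['X] up to sign. For the innermost letter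
    the first step merely gives 1. *)
Lemma lead_coef_word (w : seq letter) : w <> [::] -> reduced w ->
  let v := ring_word_vec ('X : {poly int}) w in
  `|lead_coef v.2| = 1 /\ (size v.1 <= size v.2)%N.
Proof.
elim: w => // l w IHw _ /= [hd red].
set v := ring_word_vec _ w.
set p := v.1 + _.
have lX : `|lead_coef (if l.2 then 'X else - 'X : {poly int})| = 1.
  by case: l.2; rewrite ?lead_coefN ?normrN lead_coefX normr1.
have szX : (1 < size (if l.2 then 'X else - 'X : {poly int}))%N.
  by case: l.2; rewrite ?size_polyN size_polyX.
have [lp szp] : `|lead_coef p| = 1 /\ (size v.2 <= size p)%N.
  rewrite /p /v; case: w hd red IHw @v @p => [|l' w] hd red IHw v p.
    by rewrite /= mulr0 addr0 lead_coef1 normr1 size_poly0.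
  have [||] // := IHw; rewrite -/v => lv szv.
  have [|||ld szd] := @lead_coef_subXn (head_exp l') (head_exp (linv l)).
  - exact: head_exp_gt0.
  - exact: head_exp_gt0.
  - by apply/eqP => /head_exp_inj.
  by have [lp /ltnW szp] := lead_coef_step ld szd lv szv.
by have [ly /ltnW szy] := lead_coef_step lX szX lp szp.
Qed.

Lemma norm_step (C : numDomainType) (a b c : C) :
  2 <= `|a| -> 0 < `|b| -> `|c| <= `|b| ->
  0 < `|c + a * b| /\ `|b| <= `|c + a * b|.
Proof.
move=> a2 b0 cb.
suff le : `|b| <= `|c + a * b| by split=> //; apply: lt_le_trans le.
have := lerB_normD (a * b) c; rewrite [a * b + c]addrC => le1.
apply: le_trans le1.
rewrite lerBrDr; apply: le_trans (_ : `|b| * 2 <= _).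
  by rewrite mulrDr mulr1 lerD2l.
by rewrite normrM mulrC ler_wpM2r.
Qed.

(** Factor out the smaller power, of modulus at least 1; what remains differs from a power of
    modulus at least 3 by 1. *)
Lemma norm_subX (C : numDomainType) (r : C) i j : 3 <= `|r| ->
  (0 < i)%N -> (0 < j)%N -> i != j -> 2 <= `|r ^+ i - r ^+ j|.
Proof.
move=> r3; wlog lt_ij : i j / (i < j)%N.
  move=> H i0 j0; rewrite neq_ltn => /orP[ij|ji].
    by apply: H => //; rewrite neq_ltn ij.
  by rewrite distrC; apply: H => //; rewrite neq_ltn ji.
move=> i0 _ _.
have r1 : 1 <= `|r| by apply: le_trans r3; rewrite ler1n.
rewrite -(subnK lt_ij) addnS -addSn exprD -[X in X - _]mul1r -mulrBl normrM.
rewrite -[2]mulr1; apply: ler_pM; rewrite ?ler0n ?ler01 //.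
  apply: le_trans (_ : `|r ^+ (j - i.+1).+1| - `|1 : C| <= _); last first.
    by rewrite distrC; apply: lerB_dist.
  rewrite normr1 lerBrDr natr1 normrX; apply: le_trans r3 _.
  by rewrite exprS ler_peMr // exprn_ege1.
by rewrite normrX exprn_ege1.
Qed.

(** The induction of [lead_coef_word] with moduli in place of degrees: both multipliers now have
    modulus at least 2. Consequently no root of a word polynomial has modulus 3 or more. *)
Lemma ring_word_vec_norm (C : numDomainType) (r : C) (w : seq letter) :
  3 <= `|r| -> w <> [::] -> reduced w ->
  let v := ring_word_vec r w in 0 < `|v.2| /\ `|v.1| <= `|v.2|.
Proof.
move=> r3; elim: w => // l w IHw _ /= [hd red].
set v := ring_word_vec _ w.
set p := v.1 + _.
have r2 : 2 <= `|if l.2 then r else - r|.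
  by case: l.2; rewrite ?normrN; apply: le_trans r3; rewrite ler_nat.
have [p0 szp] : 0 < `|p| /\ `|v.2| <= `|p|.
  rewrite /p /v; case: w hd red IHw @v @p => [|l' w] hd red IHw v p.
    by rewrite /= mulr0 addr0 normr1 normr0 ltr01 ler01.
  have [||] // := IHw; rewrite -/v => v0 szv.
  apply: norm_step => //; apply: norm_subX; rewrite ?head_exp_gt0 //.
  by apply/eqP => /head_exp_inj.
by have [y0 szy] := norm_step r2 p0 szp.
Qed.

(** * Powers of a real number that are roots of no word polynomial *)

Section RealPowers.
Local Notation R := Rdefinitions.R.

Lemma eventually_small (x : R) (d : nat) : `|x| < 1 ->
  exists N : nat, forall n, (N <= n)%N -> `|x| ^+ n * 3%:R ^+ d < 1.
Proof.
move=> x1.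
have B0 : 0 < 3%:R ^+ d :> R by rewrite exprn_gt0 // ltr0n.
have y0 : Rdefinitions.Rlt 0 (Rdefinitions.Rinv (3%:R ^+ d : R)).
  by apply: RIneq.Rinv_0_lt_compat; apply/RltP.
have x1' : Rdefinitions.Rlt (Rbasic_fun.Rabs x) 1 by apply/RltP; rewrite RabsE.
have [N HN] := Rfunctions.pow_lt_1_zero x x1' _ y0.
exists N => n /ssrnat.leP leNn; have := HN n leNn.
rewrite RpowE RabsE normrX => /RltP; rewrite RinvE => lt.
by rewrite -ltr_pdivlMr // div1r.
Qed.

(** The root bound 3 does not depend on the word, and [small_power_not_root] fixes its threshold
    before the polynomial, so one [N] serves all words at once. *)
Lemma ring_word_vec_free (t : R) : t <> 0 -> `|t| < 1 -> exists N : nat,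
  forall n, (N <= n)%N -> forall w : seq letter, w <> [::] -> reduced w ->
  (ring_word_vec (t ^+ n) w).2 <> 0.
Proof.
move=> t0 t1.
pose tc : R[i] := (t%:C)%C.
have tc0 : tc != 0 by rewrite (fmorph_eq0 (real_complex R)); apply/eqP.
have B1 : 1 <= 3%:R :> R[i] by rewrite ler1n.
have normtc : `|tc| = (`|t|%:C)%C.
  by rewrite /tc normc_def /= expr0n /= addr0 sqrtr_sqr.
have [|N HN] := small_power_not_root tc0 B1.
  move=> d; have [N HN] := eventually_small d t1; exists N => n /HN.
  rewrite normtc -(ltcR _ 1) rmorphM !rmorphXn /= => lt.
  by rewrite (rmorph_nat (real_complex R)) in lt.
exists N => n leNn w nnil red y0.
have [lE _] := lead_coef_word nnil red.
apply: (negP (HN n leNn _ lE _)).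
  move=> r; apply: contraTT => rN.
  have r3 : 3%:R <= `|r|.
    by have := rN; rewrite -real_ltNge ?ger0_real // => /ltW.
  have [y_gt0 _] := ring_word_vec_norm r3 nnil red.
  have := ring_word_vec_morph (horner_eval r \o map_poly (intr : int -> R[i])) 'X w.
  rewrite /= map_polyX /horner_eval hornerX => E.
  by move: y_gt0; rewrite E /= normr_gt0 /root.
have := ring_word_vec_morph (horner_eval (tc ^+ n) \o map_poly (intr : int -> R[i])) 'X w.
rewrite /= map_polyX /horner_eval hornerX => E.
have := ring_word_vec_morph (real_complex R) (t ^+ n) w.
rewrite rmorphXn /= -/tc E => -[_].
by rewrite y0 rmorph0 => /eqP.
Qed.

Lemma word_vecE (s : R) (w : list letter) : word_vec s w = ring_word_vec s w.
Proof.
elim: w => [//|l w IHw] /=; rewrite IHw !RpowE.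
suff -> : head_shift s w = ring_head_shift s w by [].
by case: w {IHw} => [//|l' w] /=; rewrite RpowE.
Qed.

Lemma word_vec_free (t : R) : t <> Rdefinitions.IZR BinNums.Z0 ->
  Rdefinitions.Rlt (Rbasic_fun.Rabs t) 1 ->
  exists N : nat, forall n, (N <= n)%coq_nat -> forall w : list letter, w <> nil ->
  reduced w -> snd (word_vec (Rpow_def.pow t n) w) <> Rdefinitions.IZR BinNums.Z0.
Proof.
rewrite RabsE => t0 /RltP t1; have [N HN] := ring_word_vec_free t0 t1.
by exists N => n /ssrnat.leP leNn w nw rw; rewrite word_vecE RpowE; apply: HN.
Qed.
End RealPowers.
End WordPolynomials.

Set Bullet Behavior "Strict Subproofs".

Lemma linvK l : linv (linv l) = l.
Proof. destruct l as [a b]; unfold linv; simpl; now rewrite Bool.negb_involutive. Qed.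

Lemma letter_eq_dec (l l' : letter) : {l = l'} + {l <> l'}.
Proof. decide equality; apply Bool.bool_dec. Qed.

(** * Paradoxical decomposition for a free action *)

Section Paradox.
Variables (Y : Type) (ok : Y -> Prop) (act : letter -> Y -> Y).
Hypothesis act_linv : forall l y, act (linv l) (act l y) = y.
Hypothesis act_ok : forall l y, ok y -> ok (act l y).

Definition act_word (w : list letter) (y : Y) : Y := fold_right act y w.

Hypothesis act_free : forall w y, w <> nil -> reduced w -> ok y -> act_word w y <> y.

Lemma act_word_ok w y : ok y -> ok (act_word w y).
Proof. induction w as [|l w IHw]; simpl; auto. Qed.

(* [rev_inv_app u v] is the word [u^-1 v]. *)
Fixpoint rev_inv_app (u v : list letter) : list letter :=
  match u with nil => v | l :: u' => rev_inv_app u' (linv l :: v) end.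

Lemma rev_inv_app_act u : forall v x y,
  act_word u x = act_word v y -> act_word (rev_inv_app u v) y = x.
Proof.
  induction u as [|l u IHu]; simpl; intros v x y E; [easy|].
  apply IHu; simpl; now rewrite <- E, act_linv.
Qed.

Lemma rev_inv_app_neq_nil u : forall v, v <> nil -> rev_inv_app u v <> nil.
Proof. induction u as [|l u IHu]; simpl; intros v nv; [easy|]. now apply IHu. Qed.

(** Distinct first letters prevent cancellation where the inverse of [u] meets [v]. *)
Lemma rev_inv_app_reduced u : forall v, reduced u -> reduced v ->
  (forall l u' l' v', u = l :: u' -> v = l' :: v' -> l <> l') ->
  reduced (rev_inv_app u v).
Proof.
  induction u as [|l u IHu]; simpl; intros v ru rv d; [easy|].
  destruct ru as [h ru]; apply IHu; auto.
  - destruct v as [|l' v]; split; auto.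
    rewrite linvK; intros E; now apply (d l u l' v).
  - intros l1 u' l2 v' -> E; injection E; intros _ <-; auto.
Qed.

Definition same_orbit (y z : Y) : Prop := exists w, y = act_word w z.

Lemma act_word_app u v y : act_word (u ++ v) y = act_word u (act_word v y).
Proof. apply fold_right_app. Qed.

Lemma same_orbit_sym y z : same_orbit y z -> same_orbit z y.
Proof.
  intros [w ->]; exists (rev_inv_app w nil).
  symmetry; now apply rev_inv_app_act.
Qed.

Lemma same_orbit_trans x y z : same_orbit x y -> same_orbit y z -> same_orbit x z.
Proof. intros [u ->] [v ->]; exists (u ++ v); now rewrite act_word_app. Qed.

Definition orbit_rep (y : Y) : Y := epsilon (inhabits y) (same_orbit y).

Lemma orbit_repP y : same_orbit y (orbit_rep y).
Proof. unfold orbit_rep; apply epsilon_spec; exists y, nil; easy. Qed.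

(** The representative is chosen from the predicate [same_orbit y], which by extensionality is the
    same for all points of an orbit. *)
Lemma orbit_rep_eq y z : same_orbit y z -> orbit_rep y = orbit_rep z.
Proof.
  intros yz; unfold orbit_rep.
  replace (same_orbit y) with (same_orbit z).
  - f_equal; apply proof_irrelevance.
  - apply functional_extensionality; intros x; apply propositional_extensionality.
    split; intros H; [|apply same_orbit_sym in yz]; now apply (same_orbit_trans _ _ _ yz).
Qed.

Lemma reduce_word w y : exists w', reduced w' /\ act_word w y = act_word w' y.
Proof.
  induction w as [|l w [w' [rw E]]]; [now exists nil|].
  destruct w' as [|l' w'].
  - exists [l]; simpl in *; rewrite E; auto.
  - destruct (letter_eq_dec l' (linv l)) as [->|n].
    + exists w'; split; [apply rw|].
      simpl in *; rewrite E; rewrite <- (linvK l) at 1; apply act_linv.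
    + exists (l :: l' :: w'); simpl in *; rewrite E; auto.
Qed.

(** Points are sorted by the first letter of the reduced word leading to them from the
    representative of their orbit. If the word for [y] does not begin with [l], it stays reduced
    after [linv l] is prepended. *)
Lemma paradoxical_sets : exists W : letter -> Y -> Prop,
  (forall l l' y, ok y -> W l y -> W l' y -> l = l') /\
  (forall l y, W l y \/ W (linv l) (act (linv l) y)).
Proof.
  exists (fun l y => exists w, reduced (l :: w) /\ y = act_word (l :: w) (orbit_rep y)).
  split.
  - intros l l' y oky [u [ru Eu]] [v [rv Ev]].
    destruct (letter_eq_dec l l') as [|n]; [easy|exfalso].
    assert (okr : ok (orbit_rep y)).
    { destruct (same_orbit_sym _ _ (orbit_repP y)) as [w ->]; now apply act_word_ok. }
    (* Two reduced words with different first letters and the same value would combine into a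
       nonempty reduced word fixing the representative. *)
    apply (act_free (rev_inv_app (l :: u) (l' :: v)) (orbit_rep y)); auto.
    + now apply rev_inv_app_neq_nil.
    + apply rev_inv_app_reduced; auto.
      intros ? ? ? ? E1 E2; injection E1; injection E2; now intros _ <- _ <-.
    + apply rev_inv_app_act; now rewrite <- Eu.
  - intros l y; destruct (orbit_repP y) as [w Ew].
    destruct (reduce_word w (orbit_rep y)) as [w' [rw E]]; rewrite E in Ew.
    destruct w' as [|l' w']; [|destruct (letter_eq_dec l' l) as [->|n]];
      [right| left; exists w'; auto| right].
    all: assert (Er : orbit_rep (act (linv l) y) = orbit_rep y)
      by (apply orbit_rep_eq; now exists [linv l]).
    + exists nil; simpl in *; rewrite Er, <- Ew; auto.
    + exists (l' :: w'); rewrite Er; simpl in *; rewrite <- Ew, linvK; auto.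
Qed.
End Paradox.

(** * Projective maps and arcs *)

Definition mmul (m n : mat) : mat :=
  Mat (ma m * ma n + mb m * mc n) (ma m * mb n + mb m * md n)
      (mc m * ma n + md m * mc n) (mc m * mb n + md m * md n).
Definition minv (m : mat) : mat := Mat (md m) (- mb m) (- mc m) (ma m).

Definition px (p : P1) : R := match p with Some x => x | None => 1 end.
Definition py (p : P1) : R := match p with Some _ => 1 | None => 0 end.

(** In homogeneous coordinates [px], [py] all cases of [mob] become one linear identity up to a
    scalar, which removes the case distinctions at poles and at infinity. *)
Lemma mob_coords m p : det m = 1 -> exists k, k <> 0 /\
  ma m * px p + mb m * py p = k * px (mob m p) /\
  mc m * px p + md m * py p = k * py (mob m p).
Proof.
  unfold det; destruct m as [a b c d], p as [x|]; simpl; intros D.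
  - destruct (Req_EM_T (c * x + d) 0) as [e|e]; simpl.
    + exists (a * x + b); repeat split; nra.
    + exists (c * x + d); repeat split; try lra; field_simplify; lra.
  - destruct (Req_EM_T c 0) as [e|e]; simpl.
    + exists a; repeat split; nra.
    + exists c; repeat split; try lra; field_simplify; lra.
Qed.

Lemma coords_inj p q k l : k <> 0 -> l <> 0 ->
  k * px p = l * px q -> k * py p = l * py q -> p = q.
Proof. destruct p, q; simpl; intros; try f_equal; nra. Qed.

Lemma mob_mmul m n p : det m = 1 -> det n = 1 ->
  mob (mmul m n) p = mob m (mob n p).
Proof.
  intros Dm Dn.
  assert (D : det (mmul m n) = 1).
  { replace (det (mmul m n)) with (det m * det n)
      by (unfold det, mmul; simpl; ring). rewrite Dm, Dn; ring. }
  destruct (mob_coords n p Dn) as [k [k0 [E1 E2]]].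
  destruct (mob_coords m (mob n p) Dm) as [l [l0 [F1 F2]]].
  destruct (mob_coords _ p D) as [j [j0 [G1 G2]]].
  apply (coords_inj _ _ j (k * l)); auto.
  - rewrite <- G1; unfold mmul; simpl.
    replace (k * l * px (mob m (mob n p))) with (k * (l * px (mob m (mob n p)))) by ring.
    rewrite <- F1.
    replace (k * (ma m * px (mob n p) + mb m * py (mob n p)))
      with (ma m * (k * px (mob n p)) + mb m * (k * py (mob n p))) by ring.
    rewrite <- E1, <- E2; ring.
  - rewrite <- G2; unfold mmul; simpl.
    replace (k * l * py (mob m (mob n p))) with (k * (l * py (mob m (mob n p)))) by ring.
    rewrite <- F2.
    replace (k * (mc m * px (mob n p) + md m * py (mob n p)))
      with (mc m * (k * px (mob n p)) + md m * (k * py (mob n p))) by ring.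
    rewrite <- E1, <- E2; ring.
Qed.

Definition mat1 := Mat 1 0 0 1.

Lemma mob_mat1 p : mob mat1 p = p.
Proof.
  destruct p as [x|]; simpl.
  - destruct (Req_EM_T (0 * x + 1) 0); [lra|f_equal; field; lra].
  - destruct (Req_EM_T 0 0); [easy|lra].
Qed.

Lemma det_minv m : det (minv m) = det m.
Proof. unfold det; simpl; ring. Qed.

Lemma det_mmul m n : det (mmul m n) = det m * det n.
Proof. unfold det; simpl; ring. Qed.

Lemma mmul_minv_l m : det m = 1 -> mmul (minv m) m = mat1.
Proof. unfold det, mmul, mat1; simpl; intros D; f_equal; nra. Qed.

Lemma mmul_minv_r m : det m = 1 -> mmul m (minv m) = mat1.
Proof. unfold det, mmul, mat1; simpl; intros D; f_equal; nra. Qed.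

Lemma minvK m : minv (minv m) = m.
Proof. destruct m; unfold minv; simpl; f_equal; ring. Qed.

Lemma mob_minv_l m p : det m = 1 -> mob (minv m) (mob m p) = p.
Proof.
  intros D; rewrite <- mob_mmul, mmul_minv_l by now rewrite ?det_minv.
  apply mob_mat1.
Qed.

Lemma mob_minv_r m p : det m = 1 -> mob m (mob (minv m) p) = p.
Proof.
  intros D; rewrite <- mob_mmul, mmul_minv_r by now rewrite ?det_minv.
  apply mob_mat1.
Qed.

Lemma mob_inj m p q : det m = 1 -> mob m p = mob m q -> p = q.
Proof. intros D E; rewrite <- (mob_minv_l m p D), E; now apply mob_minv_l. Qed.

Definition bracket (p q : P1) : R := px p * py q - py p * px q.

Lemma arc_sign_real p q x : p <> q ->
  (p < q /\ (p < x \/ p = x) /\ (x < q \/ x = q) \/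
   q < p /\ ((p < x \/ p = x) \/ x < q \/ x = q)) <->
  (p - q) * (q - x) * (x - p) <= 0.
Proof.
  intros n.
  assert (M : forall a b c, 0 < a -> 0 < b -> 0 < c -> 0 < a * b * c)
    by (intros; repeat apply Rmult_lt_0_compat; assumption).
  destruct (Rtotal_order p q) as [A|[A|A]]; [|lra|];
  (destruct (Rtotal_order q x) as [B|[B|B]];
    [|subst x; split; intros; [replace (q - q) with 0 by ring; lra|lra]|]);
  (destruct (Rtotal_order x p) as [C|[C|C]];
    [|subst x; split; intros; [replace (p - p) with 0 by ring; lra|lra]|]);
  try lra.
  - pose proof (M (q - p) (x - q) (x - p) ltac:(lra) ltac:(lra) ltac:(lra)).
    split; intros; [lra|nra].
  - pose proof (M (q - p) (q - x) (p - x) ltac:(lra) ltac:(lra) ltac:(lra)).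
    split; intros; [lra|nra].
  - pose proof (M (q - p) (q - x) (x - p) ltac:(lra) ltac:(lra) ltac:(lra)).
    split; intros; [nra|lra].
  - pose proof (M (p - q) (x - q) (p - x) ltac:(lra) ltac:(lra) ltac:(lra)).
    split; intros; [lra|nra].
  - pose proof (M (p - q) (x - q) (x - p) ltac:(lra) ltac:(lra) ltac:(lra)).
    split; intros; [nra|lra].
  - pose proof (M (p - q) (q - x) (p - x) ltac:(lra) ltac:(lra) ltac:(lra)).
    split; intros; [nra|lra].
Qed.

(* The cyclic order is the sign of a product of three 2x2 determinants, which
   elements of SL_2 only change by positive factors. *)
Lemma in_arc_bracket p q x : p <> q ->
  in_arc p q x <-> bracket p q * bracket q x * bracket x p <= 0.
Proof.
  assert (S : forall a b : R, Some a = Some b <-> a = b)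
    by (split; [now injection 1|now intros ->]).
  assert (SN : forall a : R, Some a = None <-> False) by easy.
  assert (NS : forall a : R, None = Some a <-> False) by easy.
  assert (NN : @None R = None <-> True) by easy.
  unfold in_arc, ple, bracket; destruct p as [p|], q as [q|], x as [x|]; simpl;
    rewrite ?S, ?SN, ?NS, ?NN; intros n; try tauto.
  - rewrite arc_sign_real by assumption.
    split; intros; nra.
  - split; intros; nra.
  - split; intros; nra.
  - split; intros; nra.
  - split; intros; nra.
  - split; intros; nra.
Qed.

Lemma mob_in_arc m p q x : det m = 1 -> p <> q ->
  in_arc p q x <-> in_arc (mob m p) (mob m q) (mob m x).
Proof.
  intros D n.
  assert (n' : mob m p <> mob m q) by (intros E; now apply n, (mob_inj m)).
  rewrite !in_arc_bracket by assumption.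
  destruct (mob_coords m p D) as [i [i0 [P1 P2]]].
  destruct (mob_coords m q D) as [j [j0 [Q1 Q2]]].
  destruct (mob_coords m x D) as [k [k0 [X1 X2]]].
  assert (B : forall a b r s, ma m * px a + mb m * py a = r * px (mob m a) ->
    mc m * px a + md m * py a = r * py (mob m a) ->
    ma m * px b + mb m * py b = s * px (mob m b) ->
    mc m * px b + md m * py b = s * py (mob m b) ->
    bracket a b = r * s * bracket (mob m a) (mob m b)).
  { intros a b r s E1 E2 F1 F2; unfold bracket.
    replace (r * s * (px (mob m a) * py (mob m b) - py (mob m a) * px (mob m b)))
      with (r * px (mob m a) * (s * py (mob m b)) - r * py (mob m a) * (s * px (mob m b)))
      by ring.
    rewrite <- E1, <- E2, <- F1, <- F2.
    transitivity (det m * (px a * py b - py a * px b)); [rewrite D|unfold det]; ring. }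
  rewrite (B p q i j), (B q x j k), (B x p k i) by assumption.
  set (u := bracket (mob m p) (mob m q)); set (v := bracket (mob m q) (mob m x)).
  set (w := bracket (mob m x) (mob m p)).
  replace (i * j * u * (j * k * v) * (k * i * w))
    with ((i * j * k) ^ 2 * (u * v * w)) by ring.
  assert (0 < (i * j * k) ^ 2).
  { apply pow2_gt_0; repeat apply Rmult_integral_contrapositive_currified; assumption. }
  split; intros; nra.
Qed.

(** * Cyclic order in real coordinates and subdivision of arcs *)

(** An order embedding into the reals, as 2 exceeds every value of [atan]; statements about arcs
    become linear arithmetic. *)
Definition enc (p : P1) : R := match p with Some x => atan x | None => 2 end.

Lemma enc_plt p q : plt p q <-> enc p < enc q.
Proof.
  assert (H : forall x, atan x < 2).
  { intros x; pose proof (atan_bound x); pose proof PI_4; lra. }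
  destruct p as [x|], q as [y|]; simpl; split; intros L; auto; try lra.
  - now apply atan_increasing.
  - destruct (Rtotal_order x y) as [|[->|G]]; auto; [lra|].
    apply atan_increasing in G; lra.
  - specialize (H y); lra.
Qed.

Lemma enc_inj p q : enc p = enc q -> p = q.
Proof.
  assert (H : forall x, atan x < 2).
  { intros x; pose proof (atan_bound x); pose proof PI_4; lra. }
  destruct p as [x|], q as [y|]; simpl; intros E; auto.
  - destruct (Rtotal_order x y) as [G|[->|G]]; auto; apply atan_increasing in G; lra.
  - specialize (H x); lra.
  - specialize (H y); lra.
Qed.

Definition arcR (p q x : R) : Prop :=
  p < q /\ p <= x <= q \/ q < p /\ (p <= x \/ x <= q).

Lemma in_arc_enc p q x : in_arc p q x <-> arcR (enc p) (enc q) (enc x).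
Proof.
  assert (L : forall a b, ple a b <-> enc a <= enc b).
  { intros a b; unfold ple; rewrite enc_plt; split.
    - intros [?| ->]; lra.
    - intros [|E]; [auto|right; now apply enc_inj]. }
  unfold in_arc, arcR; rewrite !enc_plt, !L; tauto.
Qed.

Definition strictly_in (p q x : P1) : Prop := in_arc p q x /\ x <> p /\ x <> q.

Lemma enc_neq p q : p <> q <-> enc p <> enc q.
Proof. split; intros H E; apply H; [now apply enc_inj|now rewrite E]. Qed.

Lemma in_arc_split p q x z : in_arc p q x -> strictly_in p q z ->
  in_arc p z x \/ in_arc z q x.
Proof.
  unfold strictly_in; rewrite !enc_neq, !in_arc_enc; unfold arcR.
  intros H [H1 [H2 H3]]; lra.
Qed.

Lemma sub_arc p q z x : strictly_in p q z ->
  (in_arc p z x -> in_arc p q x) /\ (in_arc z q x -> in_arc p q x) /\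
  (strictly_in p z x -> strictly_in p q x) /\
  (strictly_in z q x -> strictly_in p q x).
Proof.
  unfold strictly_in; rewrite !enc_neq, !in_arc_enc; unfold arcR.
  intros [H1 [H2 H3]]; repeat split; lra.
Qed.

(** Moving inside the arc from [p] to [q], one can leave the arc from [a] to [b] only through an
    endpoint; hence one common point [w] in the interior suffices. *)
Lemma arc_subset p q a b w y : ~ strictly_in p q a -> ~ strictly_in p q b ->
  strictly_in p q w -> in_arc a b w -> in_arc p q y -> in_arc a b y.
Proof.
  unfold strictly_in; rewrite !enc_neq, !in_arc_enc; unfold arcR.
  generalize (enc p) (enc q) (enc a) (enc b) (enc w) (enc y).
  clear; intros p q a b w y Ha Hb Hw Hab Hy.
  assert (out : forall c, ~ (arcR p q c /\ c <> p /\ c <> q) ->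
    (p < q -> c <= p \/ q <= c) /\ (q < p -> q <= c <= p)).
  { clear; unfold arcR; intros c Hc; split; intros L.
    - destruct (Rle_dec c p); auto; destruct (Rle_dec q c); auto.
      exfalso; apply Hc; repeat split; lra.
    - split; apply Rnot_lt_le; intros G; apply Hc; repeat split; lra. }
  destruct (out a Ha) as [A1 A2], (out b Hb) as [B1 B2]; clear out Ha Hb.
  unfold arcR in *; destruct Hw as [Hw [wp wq]].
  apply Rdichotomy in wp; apply Rdichotomy in wq.
  destruct Hw as [[L Hw]|[L Hw]];
    [specialize (A1 L); specialize (B1 L)|specialize (A2 L); specialize (B2 L)];
    lra.
Qed.

(** Cut the current arc at each point of [Z] that falls strictly inside it, keeping the half that
    contains [x]. *)
Lemma arc_refine (Z : list P1) p q x : p <> q -> in_arc p q x ->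
  exists p' q', In p' (p :: q :: Z) /\ In q' (p :: q :: Z) /\ p' <> q' /\
    in_arc p' q' x /\ (forall y, in_arc p' q' y -> in_arc p q y) /\
    (forall z, In z Z -> ~ strictly_in p' q' z).
Proof.
  intros n Hx; induction Z as [|z Z IHZ].
  - exists p, q; simpl; intuition.
  - destruct IHZ as [p' [q' [Ip [Iq [n' [Hx' [Hsub Hno]]]]]]].
    assert (I : forall r, In r (p :: q :: Z) -> In r (p :: q :: z :: Z))
      by (simpl; tauto).
    destruct (classic (strictly_in p' q' z)) as [Hz|Hz].
    + assert (Iz : In z (p :: q :: z :: Z)) by (simpl; auto).
      destruct Hz as [Hz [zp zq]].
      assert (Hz' : strictly_in p' q' z) by (split; auto).
      destruct (in_arc_split _ _ _ _ Hx' Hz'); [exists p', z|exists z, q'];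
        (repeat split); auto; try congruence.
      * intros y Hy; apply Hsub; destruct (sub_arc p' q' z y Hz') as [S1 [S2 _]]; auto.
      * intros r [<-|Ir] [Hr [r1 r2]]; [now apply r2|].
        destruct (sub_arc p' q' z r Hz') as [_ [_ [S3 S4]]].
        apply (Hno r Ir); unfold strictly_in in *; auto.
      * intros y Hy; apply Hsub; destruct (sub_arc p' q' z y Hz') as [S1 [S2 _]]; auto.
      * intros r [<-|Ir] [Hr [r1 r2]]; [now apply r1|].
        destruct (sub_arc p' q' z r Hz') as [_ [_ [S3 S4]]].
        apply (Hno r Ir); unfold strictly_in in *; auto.
    + exists p', q'; repeat split; auto.
      intros r [<-|Ir]; auto.
Qed.

Lemma strictly_in_inhabited p q : p <> q -> exists w, strictly_in p q w.
Proof.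
  unfold strictly_in, in_arc, ple; intros n.
  assert (S : forall a b : R, a <> b -> Some a <> Some b) by (injection 2; auto).
  destruct p as [p|], q as [q|]; try congruence.
  - assert (p <> q) by congruence.
    destruct (Rlt_le_dec p q).
    + exists (Some ((p + q) / 2)); simpl; repeat split; try (apply S; lra).
      left; repeat split; try left; lra.
    + exists None; simpl; repeat split; try easy.
      right; split; [lra|tauto].
  - exists (Some (p + 1)); simpl; repeat split; try easy; try (apply S; lra).
    left; repeat split; try left; auto; lra.
  - exists (Some (q - 1)); simpl; repeat split; try easy; try (apply S; lra).
    right; repeat split; right; left; lra.
Qed.

Lemma in_arc_total p q x : p <> q -> in_arc p q x \/ in_arc q p x.
Proof.
  rewrite enc_neq, !in_arc_enc; unfold arcR; intros n.
  apply Rdichotomy in n; lra.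
Qed.

(** * Closure of [inH_A] under composition, and the pieces of inverses *)

Lemma SL2_mmul A m n : is_subring A -> SL2 A m -> SL2 A n -> SL2 A (mmul m n).
Proof.
  intros [A0 [A1 [AD [AN AM]]]] [a [b [c [d D]]]] [a' [b' [c' [d' D']]]].
  repeat split; simpl; try (apply AD; apply AM; assumption).
  rewrite det_mmul, D, D'; ring.
Qed.

Lemma SL2_minv A m : is_subring A -> SL2 A m -> SL2 A (minv m).
Proof.
  intros [A0 [A1 [AD [AN AM]]]] [a [b [c [d D]]]].
  repeat split; simpl; auto; now rewrite det_minv.
Qed.

Lemma SL2_det A m : SL2 A m -> det m = 1.
Proof. now intros [_ [_ [_ [_ D]]]]. Qed.

(** Conjugation by [m] preserves the trace and moves the fixed point by [m]. *)
Lemma P_A_mob A m p : is_subring A -> SL2 A m -> P_A A p -> P_A A (mob m p).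
Proof.
  intros hA Sm [h [Sh [Hh Fh]]].
  pose proof (SL2_det _ _ Sm) as Dm; pose proof (SL2_det _ _ Sh) as Dh.
  pose proof (SL2_minv _ _ hA Sm) as Si; pose proof (SL2_det _ _ Si) as Di.
  pose proof (SL2_mmul _ _ _ hA Sh Si) as Shi; pose proof (SL2_det _ _ Shi) as Dhi.
  exists (mmul m (mmul h (minv m))); split; [now apply SL2_mmul|split].
  - unfold hyperbolic in *.
    replace (ma _ + md _) with (det m * (ma h + md h))
      by (unfold det; simpl; ring).
    now rewrite Dm, Rmult_1_l.
  - rewrite !mob_mmul, mob_minv_l, Fh; auto.
Qed.

Lemma filter_classic {T : Type} (P : T -> Prop) (s : list T) :
  exists s', forall x, In x s' <-> In x s /\ P x.
Proof.
  induction s as [|a s [s' IHs]]; [exists nil; simpl; tauto|].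
  destruct (classic (P a)) as [Pa|Pa]; [exists (a :: s')|exists s'];
    intros x; simpl; rewrite IHs; intuition; subst; auto; contradiction.
Qed.

(** Finiteness is automatic when endpoints and matrices come from the finite lists [T] and [M]: take
    all valid triples. *)
Lemma pieces_of_candidates (S : mat -> Prop) (B : P1 -> Prop) (g : P1 -> P1)
    (T : list P1) (M : list mat) :
  (forall x, exists p q m, In p T /\ In q T /\ In m M /\ in_arc p q x /\
     p <> q /\ B p /\ B q /\ S m /\ (forall y, in_arc p q y -> g y = mob m y)) ->
  piecewise_in S B g.
Proof.
  intros H; right.
  destruct (filter_classic (fun pc => let '(p, q, m) := pc in
     p <> q /\ B p /\ B q /\ S m /\ (forall y, in_arc p q y -> g y = mob m y))
     (list_prod (list_prod T T) M)) as [L HL].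
  exists L; split.
  - intros x; destruct (H x) as [p [q [m [Ip [Iq [Im [Hx Hpc]]]]]]].
    exists (p, q, m); split; auto.
    apply HL; split; auto; repeat apply in_prod; auto.
  - intros p q m I; now apply HL in I.
Qed.

Section Group.
Variable A : R -> Prop.
Hypothesis hA : is_subring A.

(** The integer matrix [Mat 2 1 1 1] has trace 3 and fixes the golden ratio and its conjugate. The
    two points allow a globally projective map to be cut into two arcs. *)
Lemma two_points_P_A : exists p q, p <> q /\ P_A A p /\ P_A A q.
Proof.
  destruct hA as [A0 [A1 [AD [AN AM]]]].
  assert (s5 : sqrt 5 * sqrt 5 = 5) by (apply sqrt_sqrt; lra).
  assert (s0 : 0 < sqrt 5) by (apply sqrt_lt_R0; lra).
  assert (s3 : sqrt 5 < 3) by nra.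
  assert (F : forall x, x * x - x - 1 = 0 -> x + 1 <> 0 -> P_A A (Some x)).
  { intros x Ex nx; exists (Mat 2 1 1 1); (repeat split); simpl; auto.
    - replace 2 with (1 + 1) by ring; auto.
    - unfold det; simpl; ring.
    - unfold hyperbolic; simpl; rewrite Rabs_pos_eq; lra.
    - destruct (Req_EM_T (1 * x + 1) 0); [lra|f_equal].
      apply Rmult_eq_reg_r with (1 * x + 1); auto; field_simplify; nra. }
  exists (Some ((1 + sqrt 5) / 2)), (Some ((1 - sqrt 5) / 2)); repeat split.
  - injection 1; lra.
  - apply F; nra.
  - apply F; nra.
Qed.

Lemma piecewise_arcs g : piecewise_in (SL2 A) (P_A A) g ->
  exists pieces : list (P1 * P1 * mat),
     (forall x, exists p q m, In (p, q, m) pieces /\ in_arc p q x) /\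
     (forall p q m, In (p, q, m) pieces ->
        p <> q /\ P_A A p /\ P_A A q /\ SL2 A m /\ forall x, in_arc p q x -> g x = mob m x).
Proof.
  intros [[m [Sm E]]|[L [H1 H2]]].
  - destruct two_points_P_A as [p [q [n [Pp Pq]]]].
    exists [(p, q, m); (q, p, m)]; split.
    + intros x; destruct (in_arc_total p q x n); [exists p, q, m|exists q, p, m];
        simpl; auto.
    + intros p' q' m' [I|[I|[]]]; injection I; intros <- <- <-; auto 10.
  - exists L; split; auto.
    intros x; destruct (H1 x) as [[[p q] m] H]; now exists p, q, m.
Qed.

(** Refine each piece of [h] by the endpoints of [g] pulled back through it. The image of a refined
    arc has no endpoint of [g] inside, so the piece of [g] met at one interior point [w] covers all
    of it. *)
Lemma piecewise_comp g h : piecewise_in (SL2 A) (P_A A) g ->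
  piecewise_in (SL2 A) (P_A A) h -> piecewise_in (SL2 A) (P_A A) (fun x => g (h x)).
Proof.
  intros Hg Hh.
  destruct (piecewise_arcs g Hg) as [Lg [Cg Vg]].
  destruct (piecewise_arcs h Hh) as [Lh [Ch Vh]].
  set (ends := fun L : list (P1 * P1 * mat) =>
    map (fun pc => fst (fst pc)) L ++ map (fun pc => snd (fst pc)) L).
  assert (Iends : forall L p q m, In (p, q, m) L -> In p (ends L) /\ In q (ends L)).
  { intros L p q m I; unfold ends; split; apply in_or_app; [left|right].
    - now apply (in_map (fun pc => fst (fst pc)) L (p, q, m)).
    - now apply (in_map (fun pc => snd (fst pc)) L (p, q, m)). }
  assert (Pends : forall z, In z (ends Lg) -> P_A A z).
  { intros z I; unfold ends in I; apply in_app_or in I; destruct I as [I|I];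
    apply in_map_iff in I; destruct I as [[[p q] m] [<- I]]; now apply Vg in I. }
  apply pieces_of_candidates with
    (T := ends Lh ++ map (fun u => mob (minv (snd (fst u))) (snd u))
             (list_prod Lh (ends Lg)))
    (M := map (fun u => mmul (snd (fst u)) (snd (snd u))) (list_prod Lg Lh)).
  intros x; destruct (Ch x) as [p [q [m [Im Hx]]]].
  destruct (Vh p q m Im) as [n [Pp [Pq [Sm Em]]]].
  pose proof (SL2_det _ _ Sm) as Dm.
  set (Z := map (mob (minv m)) (ends Lg)).
  destruct (arc_refine Z p q x n Hx) as [p' [q' [Ip [Iq [n' [Hx' [Hsub Hno]]]]]]].
  destruct (strictly_in_inhabited p' q' n') as [w Hw].
  destruct (Cg (mob m w)) as [a [b [k [Ik Hk]]]].
  destruct (Vg a b k Ik) as [nab [Pa [Pb [Sk Ek]]]].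
  pose proof (SL2_minv _ _ hA Sm) as Si; pose proof (SL2_det _ _ Si) as Di.
  assert (IT : forall r, In r (p :: q :: Z) ->
    In r (ends Lh ++ map (fun u => mob (minv (snd (fst u))) (snd u))
             (list_prod Lh (ends Lg))) /\ P_A A r).
  { assert (E := Iends Lh p q m Im).
    intros r [<-|[<-|Ir]]; [| |apply in_map_iff in Ir; destruct Ir as [z [<- Iz]]];
      (split; [apply in_or_app|]); try tauto.
    - right; apply in_map_iff; exists ((p, q, m), z); split; auto.
      now apply in_prod.
    - apply P_A_mob; auto. }
  exists p', q', (mmul k m); repeat split; try now apply IT.
  - apply in_map_iff; exists ((a, b, k), (p, q, m)); split; auto.
    now apply in_prod.
  - assumption.
  - assumption.
  - apply (SL2_mmul A k m hA Sk Sm).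
  - apply (SL2_mmul A k m hA Sk Sm).
  - apply (SL2_mmul A k m hA Sk Sm).
  - apply (SL2_mmul A k m hA Sk Sm).
  - apply (SL2_mmul A k m hA Sk Sm).
  - intros y Hy; rewrite mob_mmul by (auto; now apply (SL2_det A)).
    rewrite (Em y) by auto; apply Ek.
    destruct (Iends Lg a b k Ik) as [Ia Ib].
    rewrite <- (mob_minv_r m a Dm), <- (mob_minv_r m b Dm).
    rewrite <- mob_in_arc; auto; [|intros E; apply nab, (mob_inj (minv m)); auto].
    apply (arc_subset p' q' _ _ w).
    + apply Hno; now apply in_map.
    + apply Hno; now apply in_map.
    + assumption.
    + rewrite (mob_in_arc m), !mob_minv_r; auto.
      intros E; apply nab, (mob_inj (minv m)); auto.
    + assumption.
Qed.

Lemma homeomorphism_comp g h : homeomorphism g -> homeomorphism h ->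
  homeomorphism (fun x => g (h x)).
Proof.
  assert (C : forall a b, pcontinuous a -> pcontinuous b -> pcontinuous (fun x => a (b x))).
  { intros a b Ca Cb p eps e0.
    destruct (Ca (b p) eps e0) as [d [d0 Hd]].
    destruct (Cb p d d0) as [d' [d'0 Hd']]; exists d'; auto. }
  intros [g' [G1 [G2 [G3 G4]]]] [h' [H1 [H2 [H3 H4]]]].
  exists (fun x => h' (g' x)); repeat split; auto.
  - intros p; now rewrite G1, H1.
  - intros p; now rewrite H2, G2.
Qed.

Lemma inH_A_comp g h : inH_A A g -> inH_A A h -> inH_A A (fun x => g (h x)).
Proof.
  intros [[G1 G2] G3] [[H1 H2] H3]; repeat split.
  - now apply homeomorphism_comp.
  - now apply piecewise_comp.
  - now rewrite H3, G3.
Qed.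

(** The breakpoints of the inverse are the images of those of [h]. An interval avoiding them lies in
    the image of a single piece, found from its midpoint, and there the inverse is [minv m]. *)
Lemma inverse_pieces h : inH_A A h ->
  exists B : list R, forall x y, x < y -> (forall b, In b B -> ~ x < b < y) ->
  exists m, SL2 A m /\ forall z, x <= z <= y -> h (mob m (Some z)) = Some z.
Proof.
  intros [[[k [hk1 [hk2 _]]] Hh] _]; destruct (piecewise_arcs h Hh) as [L [C V]].
  (* The default 0 for infinity only adds a harmless breakpoint, since infinity is never inside a
     bounded interval. *)
  set (val := fun p : P1 => match p with Some r => r | None => 0 end).
  exists (map (fun pc => val (mob (snd pc) (fst (fst pc)))) L ++
          map (fun pc => val (mob (snd pc) (snd (fst pc)))) L).
  intros x y xy Hno.
  assert (xyw : strictly_in (Some x) (Some y) (Some ((x + y) / 2))).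
  { unfold strictly_in, in_arc, ple; simpl; repeat split.
    - left; repeat split; try left; lra.
    - intros E; injection E; lra.
    - intros E; injection E; lra. }
  destruct (C (k (Some ((x + y) / 2)))) as [p [q [m [I Hw]]]].
  destruct (V p q m I) as [n [_ [_ [Sm E]]]].
  pose proof (SL2_det _ _ Sm) as Dm.
  assert (Hw' : in_arc (mob m p) (mob m q) (Some ((x + y) / 2))).
  { rewrite <- (hk2 (Some _)), (E _ Hw), <- mob_in_arc; auto. }
  assert (noend : forall r, (In (val r) (map (fun pc => val (mob (snd pc) (fst (fst pc)))) L ++
          map (fun pc => val (mob (snd pc) (snd (fst pc)))) L)) ->
          ~ strictly_in (Some x) (Some y) r).
  { intros [r|] Ir [[H|H] [H1 H2]]; unfold ple in H; simpl in H.
    - apply (Hno r Ir); destruct H as [_ [[G1|G1] [G2|G2]]]; try congruence; lra.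
    - lra.
    - intuition congruence.
    - lra. }
  exists (minv m); split; [now apply SL2_minv|].
  intros z xyz; rewrite E; [now apply mob_minv_r|].
  rewrite (mob_in_arc m), mob_minv_r by auto.
  apply (arc_subset (Some x) (Some y) _ _ (Some ((x + y) / 2))); auto.
  - apply noend, in_or_app; left.
    now apply (in_map (fun pc => val (mob (snd pc) (fst (fst pc)))) L (p, q, m)).
  - apply noend, in_or_app; right.
    now apply (in_map (fun pc => val (mob (snd pc) (snd (fst pc)))) L (p, q, m)).
  - left; unfold ple; simpl; repeat split; auto.
    + destruct (proj1 xyz) as [G|G]; [left|right]; congruence || auto.
    + destruct (proj2 xyz) as [G|G]; [left|right]; congruence || auto.
Qed.
End Group.

(** * Homeomorphisms of the circle from Lipschitz maps of the line *)

Lemma sqrt_1_sqr_compare x y B : 0 <= B -> Rabs (y - x) <= B ->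
  sqrt (1 + x ^ 2) <= (1 + B) * sqrt (1 + y ^ 2).
Proof.
  intros B0 H.
  assert (H1 : 0 <= sqrt (1 + y ^ 2)) by apply sqrt_pos.
  assert (H2 : sqrt (1 + y ^ 2) * sqrt (1 + y ^ 2) = 1 + y ^ 2) by (apply sqrt_sqrt; nra).
  set (s := sqrt (1 + y ^ 2)) in *.
  assert (1 <= s) by nra.
  assert (Rabs y <= s) by (unfold Rabs; destruct (Rcase_abs y); nra).
  rewrite <- (sqrt_pow2 ((1 + B) * s)) by nra.
  apply sqrt_le_1; try nra.
  assert (xx : Rabs x ^ 2 = x ^ 2) by apply pow2_abs.
  assert (yy : Rabs y ^ 2 = y ^ 2) by apply pow2_abs.
  assert (Rabs x <= Rabs y + B).
  { replace x with (y - (y - x)) by ring; unfold Rminus at 1.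
    eapply Rle_trans; [apply Rabs_triang|rewrite Rabs_Ropp; lra]. }
  pose proof (Rabs_pos x); pose proof (Rabs_pos y).
  assert (Rabs x ^ 2 <= (Rabs y + B) ^ 2) by (apply pow_incr; lra).
  assert (B * Rabs y <= B * (s * s)) by (apply Rmult_le_compat_l; nra).
  assert (B * B <= B * B * (s * s)) by nra.
  nra.
Qed.

(** The chordal distance is the difference times the two weights [1 / sqrt (1 + x ^ 2)]. The
    Lipschitz bound controls the difference, and bounded displacement controls the weights, hence
    also continuity at infinity. *)
Lemma lipschitz_homeomorphism (f k : R -> R) (L B : R) : 0 < L -> 0 <= B ->
  (forall x, k (f x) = x) -> (forall x, f (k x) = x) ->
  (forall x y, Rabs (f x - f y) <= L * Rabs (x - y)) ->
  (forall x y, Rabs (k x - k y) <= L * Rabs (x - y)) ->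
  (forall x, Rabs (f x - x) <= B) ->
  homeomorphism (option_map f).
Proof.
  intros L0 B0 kf fk Lf Lk Bf.
  assert (Bk : forall x, Rabs (k x - x) <= B).
  { intros x; rewrite <- (fk x) at 2; now rewrite Rabs_minus_sym. }
  assert (cont : forall u : R -> R, (forall x y, Rabs (u x - u y) <= L * Rabs (x - y)) ->
    (forall x, Rabs (u x - x) <= B) -> pcontinuous (option_map u)).
  { clear - L0 B0; intros u Lu Bu p eps e0.
    assert (M0 : 0 < (1 + L) * ((1 + B) * (1 + B)))
      by (apply Rmult_lt_0_compat; [lra|apply Rmult_lt_0_compat; lra]).
    (* The divisor is a chordal Lipschitz constant: [1 + B] for each weight, and [1 + L] instead of
       [L] to cover also the case of a point at infinity. *)
    exists (eps / ((1 + L) * ((1 + B) * (1 + B)))); split.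
    - now apply Rdiv_lt_0_compat.
    - intros q Hq; apply Rlt_div_r in Hq; auto.
      refine (Rle_lt_trans _ _ _ _ Hq); clear Hq.
      assert (s0 : forall x, 0 < sqrt (1 + x ^ 2)) by (intros x; apply sqrt_lt_R0; nra).
      assert (cmp : forall x, 1 / sqrt (1 + u x ^ 2) <= (1 + B) * (1 / sqrt (1 + x ^ 2))).
      { intros x; specialize (Bu x).
        pose proof (sqrt_1_sqr_compare x (u x) B B0 Bu) as H.
        pose proof (s0 x); pose proof (s0 (u x)).
        apply Rle_div_l; auto.
        replace ((1 + B) * (1 / sqrt (1 + x ^ 2)) * sqrt (1 + u x ^ 2))
          with ((1 + B) * sqrt (1 + u x ^ 2) / sqrt (1 + x ^ 2)) by (field; lra).
        apply Rle_div_r; lra. }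
      assert (pos : forall x, 0 < 1 / sqrt (1 + x ^ 2))
        by (intros x; apply Rdiv_lt_0_compat; auto; lra).
      destruct p as [x|], q as [y|]; simpl.
      + replace (Rabs (x - y) / (sqrt (1 + x * (x * 1)) * sqrt (1 + y * (y * 1))))
          with (Rabs (x - y) * ((1 / sqrt (1 + x ^ 2)) * (1 / sqrt (1 + y ^ 2))))
          by (pose proof (s0 x); pose proof (s0 y); simpl in *; field; lra).
        replace (Rabs (u x - u y) / (sqrt (1 + u x * (u x * 1)) * sqrt (1 + u y * (u y * 1))))
          with (Rabs (u x - u y) * ((1 / sqrt (1 + u x ^ 2)) * (1 / sqrt (1 + u y ^ 2))))
          by (pose proof (s0 (u x)); pose proof (s0 (u y)); simpl in *; field; lra).
        pose proof (cmp x) as cx; pose proof (cmp y) as cy; specialize (Lu x y).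
        pose proof (pos x) as X0; pose proof (pos y) as Y0.
        pose proof (pos (u x)) as UX0; pose proof (pos (u y)) as UY0.
        set (X := 1 / sqrt (1 + x ^ 2)) in *; set (Y := 1 / sqrt (1 + y ^ 2)) in *.
        set (UX := 1 / sqrt (1 + u x ^ 2)) in *; set (UY := 1 / sqrt (1 + u y ^ 2)) in *.
        pose proof (Rabs_pos (x - y)) as D0.
        assert (E : UX * UY <= ((1 + B) * X) * ((1 + B) * Y))
          by (apply Rmult_le_compat; lra).
        apply Rle_trans with ((1 + L) * Rabs (x - y) * (((1 + B) * X) * ((1 + B) * Y)));
          [|right; ring].
        apply Rmult_le_compat; auto; try apply Rabs_pos; nra.
      + specialize (cmp x); specialize (pos x); simpl in *.
        apply Rle_trans with (1 := cmp).
        rewrite Rmult_comm; apply Rmult_le_compat_l; nra.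
      + specialize (cmp y); specialize (pos y); simpl in *.
        apply Rle_trans with (1 := cmp).
        rewrite Rmult_comm; apply Rmult_le_compat_l; nra.
      + lra. }
  exists (option_map k); repeat split; auto.
  - intros [x|]; simpl; congruence.
  - intros [x|]; simpl; congruence.
Qed.

(** * Local elements of H(A) *)

(** With denominators cleared, [m] agrees with the translation by [r] at both ends; positivity there
    keeps the pole off the whole interval. *)
Definition gluable (m : mat) (x1 x2 r : R) : Prop :=
  det m = 1 /\ x1 < x2 /\ 0 < mc m * x1 + md m /\ 0 < mc m * x2 + md m /\
  ma m * x1 + mb m = (x1 + r) * (mc m * x1 + md m) /\
  ma m * x2 + mb m = (x2 + r) * (mc m * x2 + md m).

(** The denominators of [m] at [x] and of its inverse at the image of [x] are reciprocal, so
    positivity carries over. *)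
Lemma gluable_minv m x1 x2 r : gluable m x1 x2 r ->
  gluable (minv m) (x1 + r) (x2 + r) (- r).
Proof.
  destruct m as [a b c d]; unfold gluable, minv, det; simpl.
  intros [D [x12 [P1 [P2 [E1 E2]]]]].
  assert (pos : forall x, 0 < c * x + d -> a * x + b = (x + r) * (c * x + d) ->
    0 < - c * (x + r) + a /\ d * (x + r) + - b = (x + r + - r) * (- c * (x + r) + a)).
  { intros x P E; split; [|lra].
    assert ((- c * (x + r) + a) * (c * x + d) = 1) by nra.
    nra. }
  destruct (pos x1 P1 E1), (pos x2 P2 E2); repeat split; auto; lra.
Qed.

Definition moebius (m : mat) (x : R) : R := (ma m * x + mb m) / (mc m * x + md m).

Lemma mob_moebius m x : 0 < mc m * x + md m -> mob m (Some x) = Some (moebius m x).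
Proof. intros P; simpl; destruct (Req_EM_T (mc m * x + md m) 0); [lra|easy]. Qed.

Lemma moebius_sub m x y : det m = 1 -> 0 < mc m * x + md m -> 0 < mc m * y + md m ->
  moebius m y - moebius m x = (y - x) / ((mc m * x + md m) * (mc m * y + md m)).
Proof.
  unfold moebius, det; intros D P Q.
  replace (y - x) with ((ma m * md m - mb m * mc m) * (y - x)) by (rewrite D; ring).
  field; lra.
Qed.

Definition clamp (x1 x2 x : R) : R := Rmax x1 (Rmin x x2).

(** For a gluable [m] this is [m] on the interval and the translation by [r] outside; going through
    [clamp] gives one formula and hence one Lipschitz estimate. *)
Definition glue (m : mat) (x1 x2 x : R) : R :=
  moebius m (clamp x1 x2 x) + (x - clamp x1 x2 x).

Lemma clamp_cases x1 x2 x : x1 < x2 ->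
  x <= x1 /\ clamp x1 x2 x = x1 \/ x2 <= x /\ clamp x1 x2 x = x2 \/
  x1 <= x <= x2 /\ clamp x1 x2 x = x.
Proof.
  intros L; unfold clamp, Rmax, Rmin.
  destruct (Rle_dec x x2), (Rle_dec x1 x), (Rle_dec x1 x2); lra.
Qed.

Section Glue.
Variables (m : mat) (x1 x2 r : R).
Hypothesis H : gluable m x1 x2 r.

Lemma gluable_pos x : x1 <= x <= x2 -> 0 < mc m * x + md m.
Proof.
  destruct H as [_ [L [P1 [P2 _]]]]; intros [G1 G2].
  destruct (Rle_dec 0 (mc m)); nra.
Qed.

Lemma moebius_ends : moebius m x1 = x1 + r /\ moebius m x2 = x2 + r.
Proof.
  destruct H as [_ [L [P1 [P2 [E1 E2]]]]]; unfold moebius.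
  rewrite E1, E2; split; field; lra.
Qed.

Lemma clamp_range x : x1 <= clamp x1 x2 x <= x2.
Proof. destruct H as [_ [L _]]; destruct (clamp_cases x1 x2 x L); lra. Qed.

Lemma glue_out x : x <= x1 \/ x2 <= x -> glue m x1 x2 x = x + r.
Proof.
  destruct H as [_ [L _]]; destruct moebius_ends as [M1 M2]; unfold glue; intros O.
  destruct (clamp_cases x1 x2 x L) as [[? ->]|[[? ->]|[? ->]]]; try lra.
  destruct (Req_dec x x1) as [->|]; [lra|].
  replace x with x2 by lra; lra.
Qed.

Lemma glue_in x : x1 <= x <= x2 -> glue m x1 x2 x = moebius m x.
Proof.
  destruct H as [_ [L _]]; unfold glue; intros O.
  destruct (clamp_cases x1 x2 x L) as [[? E]|[[? E]|[? E]]]; rewrite E;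
  replace x with (clamp x1 x2 x) by lra; rewrite ?E; lra.
Qed.

Lemma moebius_range x : x1 <= x <= x2 -> x1 + r <= moebius m x <= x2 + r.
Proof.
  intros I; pose proof (gluable_pos x I) as Px.
  destruct H as [D [L [P1 [P2 _]]]]; destruct moebius_ends as [<- <-].
  assert (mono : forall u v, u <= v -> 0 < mc m * u + md m -> 0 < mc m * v + md m ->
    moebius m u <= moebius m v).
  { intros u v uv Pu Pv; apply Rminus_le_0; rewrite moebius_sub; auto.
    apply Rdiv_le_0_compat; [lra|now apply Rmult_lt_0_compat]. }
  split; apply mono; lra.
Qed.

Lemma glue_lipschitz : exists K, 0 < K /\
  forall x y, Rabs (glue m x1 x2 x - glue m x1 x2 y) <= K * Rabs (x - y).
Proof.
  set (mu := Rmin (mc m * x1 + md m) (mc m * x2 + md m)).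
  pose proof H as [D [L [P1 [P2 _]]]].
  assert (mu0 : 0 < mu) by (now apply Rmin_glb_lt).
  assert (mule : forall x, x1 <= x <= x2 -> mu <= mc m * x + md m).
  { intros x [G1 G2]; unfold mu.
    destruct (Rle_dec 0 (mc m)).
    - apply Rle_trans with (1 := Rmin_l _ _); nra.
    - apply Rle_trans with (1 := Rmin_r _ _); nra. }
  assert (i0 : 0 < / (mu * mu)) by (apply Rinv_0_lt_compat; nra).
  (* By [moebius_sub] the slope of [m] is at most [/ (mu * mu)]; the summand [x - clamp x1 x2 x]
     accounts for 2. *)
  exists (2 + / (mu * mu)); split; [lra|].
  intros x y; unfold glue.
  pose proof (clamp_range x) as Cx; pose proof (clamp_range y) as Cy.
  assert (C : Rabs (clamp x1 x2 x - clamp x1 x2 y) <= Rabs (x - y)).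
  { destruct (clamp_cases x1 x2 x L) as [[? ->]|[[? ->]|[? ->]]];
    destruct (clamp_cases x1 x2 y L) as [[? ->]|[[? ->]|[? ->]]];
    unfold Rabs; repeat destruct Rcase_abs; lra. }
  set (u := clamp x1 x2 x) in *; set (v := clamp x1 x2 y) in *.
  assert (M : Rabs (moebius m u - moebius m v) <= / (mu * mu) * Rabs (u - v)).
  { pose proof (mule u Cx); pose proof (mule v Cy).
    rewrite moebius_sub by lra.
    unfold Rdiv; rewrite Rabs_mult, Rmult_comm.
    apply Rmult_le_compat_r; [apply Rabs_pos|].
    rewrite Rabs_pos_eq; [apply Rinv_le_contravar; nra|].
    left; apply Rinv_0_lt_compat; nra. }
  replace (moebius m u + (x - u) - (moebius m v + (y - v)))
    with ((moebius m u - moebius m v) + ((x - y) + - (u - v))) by ring.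
  eapply Rle_trans; [apply Rabs_triang|].
  assert (Rabs (x - y + - (u - v)) <= Rabs (x - y) + Rabs (u - v)).
  { eapply Rle_trans; [apply Rabs_triang|rewrite Rabs_Ropp; lra]. }
  pose proof (Rabs_pos (x - y)).
  assert (/ (mu * mu) * Rabs (u - v) <= / (mu * mu) * Rabs (x - y))
    by (apply Rmult_le_compat_l; lra).
  lra.
Qed.

Lemma glue_bounded x : Rabs (glue m x1 x2 x - x) <= Rabs r + (x2 - x1).
Proof.
  pose proof H as [_ [L _]].
  destruct (Rle_dec x1 x) as [G|G]; [destruct (Rle_dec x x2)|].
  - rewrite glue_in by lra; pose proof (moebius_range x ltac:(lra)).
    pose proof (Rle_abs r); pose proof (Rle_abs (- r)); rewrite Rabs_Ropp in *.
    apply Rabs_le; lra.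
  - rewrite glue_out by lra; replace (x + r - x) with r by ring; lra.
  - rewrite glue_out by lra; replace (x + r - x) with r by ring; lra.
Qed.
End Glue.

Lemma glue_minv m x1 x2 r x : gluable m x1 x2 r ->
  glue (minv m) (x1 + r) (x2 + r) (glue m x1 x2 x) = x.
Proof.
  intros H; pose proof (gluable_minv _ _ _ _ H) as H'; pose proof H as [D [L _]].
  destruct (Rle_dec x1 x) as [G|G]; [destruct (Rle_dec x x2) as [F|F]|].
  - rewrite (glue_in m x1 x2 r) by (auto; lra).
    rewrite (glue_in _ _ _ (- r)) by (auto; apply moebius_range; auto; lra).
    assert (P : 0 < mc m * x + md m) by (apply (gluable_pos m x1 x2 r); auto; lra).
    assert (M := mob_minv_l m (Some x) D).
    rewrite (mob_moebius m x P), mob_moebius in M.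
    + now injection M.
    + apply (gluable_pos _ _ _ _ H'); apply moebius_range; auto; lra.
  - rewrite (glue_out m x1 x2 r) by (auto; lra).
    rewrite (glue_out _ _ _ (- r)) by (auto; lra); ring.
  - rewrite (glue_out m x1 x2 r) by (auto; lra).
    rewrite (glue_out _ _ _ (- r)) by (auto; lra); ring.
Qed.

Lemma glue_homeomorphism m x1 x2 r : gluable m x1 x2 r ->
  homeomorphism (option_map (glue m x1 x2)).
Proof.
  intros H; pose proof (gluable_minv _ _ _ _ H) as H'; pose proof H as [D [L _]].
  destruct (glue_lipschitz m x1 x2 r H) as [K [K0 HK]].
  destruct (glue_lipschitz _ _ _ _ H') as [K' [K0' HK']].
  apply (lipschitz_homeomorphism _ (glue (minv m) (x1 + r) (x2 + r)) (K + K') 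
    (Rabs r + (x2 - x1))).
  - lra.
  - pose proof (Rabs_pos r); lra.
  - intros x; now apply glue_minv.
  - intros x; pose proof (glue_minv _ _ _ _ x H') as E.
    rewrite minvK in E; replace (x1 + r + - r) with x1 in E by ring.
    now replace (x2 + r + - r) with x2 in E by ring.
  - intros x y; specialize (HK x y); pose proof (Rabs_pos (x - y)); nra.
  - intros x y; specialize (HK' x y); pose proof (Rabs_pos (x - y)); nra.
  - intros x; now apply glue_bounded.
Qed.

Lemma glue_inH_A A m x1 x2 r : is_subring A -> A r -> SL2 A m -> gluable m x1 x2 r ->
  P_A A (Some x1) -> P_A A (Some x2) -> inH_A A (option_map (glue m x1 x2)).
Proof.
  intros [A0 [A1 _]] Ar Sm H Q1 Q2; pose proof H as [D [L _]].
  repeat split; [now apply (glue_homeomorphism m x1 x2 r)|right].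
  exists [(Some x1, Some x2, m); (Some x2, Some x1, Mat 1 r 0 1)]; split.
  - intros x; destruct (in_arc_total (Some x1) (Some x2) x) as [I|I].
    + injection; lra.
    + eexists; split; [left; reflexivity|exact I].
    + eexists; split; [right; left; reflexivity|exact I].
  - assert (n : Some x1 <> Some x2) by (injection; lra).
    intros p q k [E|[E|[]]]; injection E; intros <- <- <-;
      (split; [auto|split; [auto|split; [auto|split]]]); auto.
    + intros x I; unfold in_arc, ple in I; simpl in I.
      destruct x as [x|]; [|destruct I as [[_ [_ [[]|I]]]|[? _]]; [congruence|lra]].
      assert (I' : x1 <= x <= x2).
      { assert (S : forall u v : R, Some u = Some v -> u = v) by now injection 1.
        destruct I as [[_ [[?|F1] [?|F2]]]|[? _]]; try apply S in F1;
        try apply S in F2; simpl in *; lra. }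
      rewrite mob_moebius by now apply (gluable_pos m x1 x2 r).
      simpl; f_equal; now apply (glue_in m x1 x2 r).
    + repeat split; simpl; auto; unfold det; simpl; ring.
    + intros x I; unfold in_arc, ple in I; simpl in I.
      destruct x as [x|]; simpl.
      * destruct (Req_EM_T (0 * x + 1) 0); [lra|f_equal].
        rewrite (glue_out m x1 x2 r); [field; lra|auto|].
        assert (S : forall u v : R, Some u = Some v -> u = v) by now injection 1.
        destruct I as [[? _]|[_ [[?|F]|[?|F]]]]; try apply S in F; simpl in *; lra.
      * destruct (Req_EM_T 0 0); [easy|lra].
Qed.

Lemma subring_IZR A z : is_subring A -> A (IZR z).
Proof.
  intros [A0 [A1 [AD [AN AM]]]].
  assert (P : forall n, A (INR n)).
  { induction n as [|n IHn]; [easy|rewrite S_INR; auto]. }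
  destruct z as [|p|p]; [easy| |].
  - rewrite <- positive_nat_Z, <- INR_IZR_INZ; auto.
  - change (IZR (Z.neg p)) with (- IZR (Z.pos p)); apply AN.
    rewrite <- positive_nat_Z, <- INR_IZR_INZ; auto.
Qed.

Lemma archimed_three a1 b1 a2 b2 a3 b3 : 0 < a1 -> 0 < a2 -> 0 < a3 ->
  exists n : nat, b1 <= INR n * a1 /\ b2 <= INR n * a2 /\ b3 <= INR n * a3.
Proof.
  intros P1 P2 P3.
  assert (S : forall a b, 0 < a -> exists n : nat, forall k, (n <= k)%nat -> b <= INR k * a).
  { intros a b P; destruct (INR_unbounded (b / a)) as [n Hn].
    exists n; intros k nk; apply le_INR in nk.
    apply Rle_div_l; auto; lra. }
  destruct (S a1 b1 P1) as [n1 H1], (S a2 b2 P2) as [n2 H2], (S a3 b3 P3) as [n3 H3].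
  exists (n1 + n2 + n3)%nat; repeat split; [apply H1|apply H2|apply H3]; lia.
Qed.

(* Monod's trick: for a large integer r of the right sign, u_(-r) m is hyperbolic
   and its fixed points x1 < x2 enclose [0,1] but not the pole of m, so m on
   [x1,x2] glues with the translation by r elsewhere. *)
Lemma local_element A m : is_subring A -> SL2 A m -> mc m <> 0 ->
  0 < md m -> 0 < mc m + md m ->
  exists g k, inH_A A g /\ inH_A A k /\ (forall x, k (g x) = x) /\ (forall x, g (k x) = x) /\
    forall x, 0 <= x <= 1 -> g (Some x) = mob m (Some x).
Proof.
  intros hA Sm c0 d0 cd0; pose proof (SL2_det _ _ Sm) as D.
  pose proof (subring_IZR A) as AZ.
  destruct m as [a b c d]; unfold det in D; simpl in D, c0, d0, cd0.
  assert (kp : 0 < Rabs c) by now apply Rabs_pos_lt.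
  (* With [r * c = - (n * Rabs c)], the first two bounds make [c] times the fixed point quadratic
     nonpositive at 0 and at 1, so its roots enclose both; the third makes the trace at least 3. *)
  destruct (archimed_three (Rabs c * d) (- c * b) (Rabs c * (c + d)) (c * (c + d - a - b))
    (Rabs c) (3 - a - d)) as [n [N1 [N2 N3]]]; try nra.
  assert (exists z, IZR z * c = - (INR n * Rabs c)) as [z Ez].
  { rewrite INR_IZR_INZ; destruct (Rcase_abs c) as [s|s].
    - exists (Z.of_nat n); rewrite (Rabs_left c s); ring.
    - exists (- Z.of_nat n)%Z; rewrite opp_IZR, (Rabs_right c s); ring. }
  set (r := IZR z) in *.
  set (p := d - a + r * c).
  assert (Disc : p * p - 4 * c * (r * d - b) = (a + d - r * c) * (a + d - r * c) - 4)
    by (unfold p; nra).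
  assert (T : 3 <= a + d - r * c) by (rewrite Ez; lra).
  set (delta := p * p - 4 * c * (r * d - b)) in *.
  assert (dp : 0 < delta) by nra.
  set (s := sqrt delta); assert (s0 : 0 < s) by now apply sqrt_lt_R0.
  assert (ss : s * s = delta) by (apply sqrt_sqrt; lra).
  set (x1 := - p / (2 * c) - s / (2 * Rabs c)).
  set (x2 := - p / (2 * c) + s / (2 * Rabs c)).
  assert (x12 : x1 < x2).
  { unfold x1, x2; assert (0 < s / (2 * Rabs c)) by (apply Rdiv_lt_0_compat; lra); lra. }
  assert (cc : Rabs c * Rabs c = c * c) by (rewrite <- Rabs_mult; apply Rabs_pos_eq; nra).
  assert (roots : forall x, c * x * x + p * x + (r * d - b) = c * ((x - x1) * (x - x2))).
  { intros x; apply Rmult_eq_reg_l with (4 * c); [|lra].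
    transitivity (4 * (c * c) * (x + p / (2 * c)) ^ 2 - delta).
    - unfold delta; field; lra.
    - rewrite <- ss; unfold x1, x2.
      transitivity (4 * (c * c) * ((x + p / (2 * c)) ^ 2 - (s * s) / (4 * (Rabs c * Rabs c)))).
      + rewrite cc; field; lra.
      + field; lra. }
  assert (C : 0 < c * c) by nra.
  assert (R0 : x1 * x2 <= 0).
  { pose proof (roots 0) as F.
    assert (c * c * (x1 * x2) <= 0) by nra. nra. }
  assert (R1 : (1 - x1) * (1 - x2) <= 0).
  { pose proof (roots 1) as F.
    assert (c * c * ((1 - x1) * (1 - x2)) <= 0) by (unfold p in F; nra). nra. }
  assert (X1 : x1 <= 0) by nra.
  assert (X2 : 1 <= x2) by nra.
  (* The two factors are the eigenvalues of [u_(-r) m]. The identity follows by evaluating the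
     quadratic at the pole [- d / c]. *)
  assert (PP : (c * x1 + d) * (c * x2 + d) = 1).
  { pose proof (roots (- d / c)) as F.
    apply Rmult_eq_reg_l with c; [|lra].
    transitivity (c * (c * c) * ((- d / c - x1) * (- d / c - x2))); [field; lra|].
    replace (c * (c * c) * ((- d / c - x1) * (- d / c - x2))) with
      (c * c * (c * ((- d / c - x1) * (- d / c - x2)))) by ring.
    rewrite <- F; unfold p.
    transitivity (c * (a * d - b * c)); [field; lra|rewrite D; ring]. }
  assert (Q1 : 0 < c * x1 + d).
  { destruct (Rle_dec 0 c); [|nra].
    assert (0 <= c * x2) by nra; nra. }
  assert (Q2 : 0 < c * x2 + d) by nra.
  assert (E1 : a * x1 + b = (x1 + r) * (c * x1 + d)).
  { pose proof (roots x1) as F; replace (x1 - x1) with 0 in F by ring.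
    unfold p in F; lra. }
  assert (E2 : a * x2 + b = (x2 + r) * (c * x2 + d)).
  { pose proof (roots x2) as F; replace (x2 - x2) with 0 in F by ring.
    unfold p in F; lra. }
  assert (H : gluable (Mat a b c d) x1 x2 r) by (repeat split; auto; lra).
  assert (Sh : SL2 A (Mat (a - r * c) (b - r * d) c d)).
  { destruct Sm as [Aa [Ab [Ac [Ad _]]]]; simpl in *; pose proof (AZ z hA) as Ar; fold r in Ar.
    destruct hA as [A0 [A1 [AD [AN AM]]]].
    repeat split; simpl; auto.
    - apply AD; auto.
    - apply AD; auto.
    - unfold det; simpl; lra. }
  assert (P_root : forall x, 0 < c * x + d -> a * x + b = (x + r) * (c * x + d) ->
    P_A A (Some x)).
  { intros x Px Ex; exists (Mat (a - r * c) (b - r * d) c d); split; [auto|split].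
    - unfold hyperbolic; simpl; rewrite Rabs_pos_eq; lra.
    - rewrite mob_moebius by auto; f_equal; unfold moebius; simpl.
      replace ((a - r * c) * x + (b - r * d)) with ((a * x + b) - r * (c * x + d)) by ring.
      rewrite Ex; field; lra. }
  pose proof (P_root x1 Q1 E1) as PA1; pose proof (P_root x2 Q2 E2) as PA2.
  pose proof (gluable_minv _ _ _ _ H) as H'.
  (* The inverse element has breakpoints [x1 + r] and [x2 + r], images of points of [P_A] under an
     integer translation. *)
  assert (P_shift : forall x, P_A A (Some x) -> P_A A (Some (x + r))).
  { intros x Hx; apply (P_A_mob A (Mat 1 r 0 1)) in Hx; auto.
    - rewrite mob_moebius in Hx by (simpl; lra).
      unfold moebius in Hx; simpl in Hx.
      now replace ((1 * x + r) / (0 * x + 1)) with (x + r) in Hx by (field; lra).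
    - pose proof (AZ z hA) as Ar; fold r in Ar; destruct hA as [A0 [A1 _]].
      repeat split; simpl; auto; unfold det; simpl; ring. }
  exists (option_map (glue (Mat a b c d) x1 x2)).
  exists (option_map (glue (minv (Mat a b c d)) (x1 + r) (x2 + r))).
  split; [|split; [|split; [|split]]].
  - apply (glue_inH_A A _ _ _ r); auto; apply AZ; auto.
  - apply (glue_inH_A A _ _ _ (- r)); auto.
    + unfold r; rewrite <- opp_IZR; now apply AZ.
    + now apply SL2_minv.
  - intros [x|]; simpl; auto; f_equal; now apply glue_minv.
  - intros [x|]; simpl; auto; f_equal.
    pose proof (glue_minv _ _ _ _ x H') as E.
    rewrite minvK in E; replace (x1 + r + - r) with x1 in E by ring.
    now replace (x2 + r + - r) with x2 in E by ring.
  - intros x I; rewrite mob_moebius by (apply (gluable_pos _ _ _ _ H); lra).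
    simpl; f_equal; apply (glue_in _ _ _ r); auto; lra.
Qed.

(** * Integrating against a mean *)

Definition chi (P : Prop) : R := if excluded_middle_informative P then 1 else 0.

Lemma chi_true (P : Prop) : P -> chi P = 1.
Proof. unfold chi; now destruct excluded_middle_informative. Qed.

Lemma chi_false (P : Prop) : ~ P -> chi P = 0.
Proof. unfold chi; now destruct excluded_middle_informative. Qed.

Lemma chi_bound (P : Prop) : 0 <= chi P <= 1.
Proof. unfold chi; destruct excluded_middle_informative; lra. Qed.

Lemma chi_iff (P Q : Prop) : (P <-> Q) -> chi P = chi Q.
Proof. intros E; now rewrite (propositional_extensionality P Q E). Qed.

Section Mean.
Variables (X : Type) (Gam : (X -> X) -> Prop) (m : ((X -> X) -> Prop) -> R).
Hypothesis m_total : m Gam = 1.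
Hypothesis m_pos : forall E, (forall k, E k -> Gam k) -> 0 <= m E.
Hypothesis m_add : forall E F, (forall k, E k -> Gam k) -> (forall k, F k -> Gam k) ->
  (forall k, E k -> F k -> False) -> m (fun k => E k \/ F k) = m E + m F.
Hypothesis m_inv : forall g E, Gam g -> (forall k, E k -> Gam k) ->
  m (fun k => exists h, E h /\ k = (fun x => g (h x))) = m E.

Lemma mean_ext E F : (forall k, E k <-> F k) -> m E = m F.
Proof.
  intros H; f_equal; apply functional_extensionality; intros k.
  now apply propositional_extensionality.
Qed.

(** A list of weighted sets encodes a simple function; [weighted_mean S] is its integral over [S]
    against the finitely additive [m]. *)
Definition weighted_sum (L : list (R * ((X -> X) -> Prop))) (h : X -> X) : R :=
  fold_right (fun u acc => fst u * chi (snd u h) + acc) 0 L.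
Definition weighted_mean (S : (X -> X) -> Prop) (L : list (R * ((X -> X) -> Prop))) : R :=
  fold_right (fun u acc => fst u * m (fun h => S h /\ snd u h) + acc) 0 L.

Lemma mean_split (S E : (X -> X) -> Prop) : (forall k, S k -> Gam k) ->
  m S = m (fun h => S h /\ E h) + m (fun h => S h /\ ~ E h).
Proof.
  intros SG; rewrite <- m_add.
  - apply mean_ext; intros k; destruct (classic (E k)); tauto.
  - intros k [H _]; auto.
  - intros k [H _]; auto.
  - intros k [_ H1] [_ H2]; auto.
Qed.

Lemma weighted_mean_split L : forall S E, (forall k, S k -> Gam k) ->
  weighted_mean S L = weighted_mean (fun h => S h /\ E h) L +
                      weighted_mean (fun h => S h /\ ~ E h) L.
Proof.
  induction L as [|[z F] L IHL]; simpl; intros S E SG; [lra|].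
  rewrite (IHL S E SG), (mean_split (fun h => S h /\ F h) E) by (intros k [H _]; auto).
  rewrite (mean_ext (fun h => (S h /\ F h) /\ E h) (fun h => (S h /\ E h) /\ F h))
    by (intros; tauto).
  rewrite (mean_ext (fun h => (S h /\ F h) /\ ~ E h) (fun h => (S h /\ ~ E h) /\ F h))
    by (intros; tauto).
  lra.
Qed.

Lemma mean_empty (S : (X -> X) -> Prop) : (forall h, ~ S h) -> m S = 0.
Proof.
  intros H; assert (E := m_add S S ltac:(intros; now apply H in H0)
    ltac:(intros; now apply H in H0) ltac:(intros; now apply H in H0)).
  rewrite (mean_ext _ S) in E by (intros; tauto); lra.
Qed.

(* The mean extends to a positive functional on simple functions; induction on
   the level sets, conditioning on the first of them. *)
Lemma mean_positive L : forall (S : (X -> X) -> Prop) c, (forall k, S k -> Gam k) ->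
  (forall h, S h -> 0 <= c + weighted_sum L h) -> 0 <= c * m S + weighted_mean S L.
Proof.
  induction L as [|[z E] L IHL]; intros S c SG H.
  - simpl in *; destruct (classic (exists h, S h)) as [[h Sh]|no].
    + specialize (H h Sh); specialize (m_pos S SG); nra.
    + rewrite mean_empty; [lra|]; intros h Sh; apply no; now exists h.
  - set (SE := fun h => S h /\ E h); set (SN := fun h => S h /\ ~ E h).
    assert (H1 : 0 <= (c + z) * m SE + weighted_mean SE L).
    { apply IHL; [intros k [? _]; auto|].
      intros h [Sh Eh]; specialize (H h Sh); simpl in H; rewrite chi_true in H; auto; lra. }
    assert (H2 : 0 <= c * m SN + weighted_mean SN L).
    { apply IHL; [intros k [? _]; auto|].
      intros h [Sh Eh]; specialize (H h Sh); simpl in H; rewrite chi_false in H; auto; lra. }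
    rewrite (mean_split S E SG); simpl.
    rewrite (weighted_mean_split L S E SG).
    fold SE SN; lra.
Qed.

(** For [y] nonnegative this is the minimum of [n] and the integer part of [y], written as a sum of
    indicators; it rounds a bounded function to a simple one. *)
Fixpoint count_levels (n : nat) (y : R) : R :=
  match n with O => 0 | S k => chi (INR n <= y) + count_levels k y end.

Lemma count_levels_floor n y : 0 <= y ->
  (INR n <= y -> count_levels n y = INR n) /\ count_levels n y <= y /\
  (y - 1 < INR n -> y - 1 <= count_levels n y).
Proof.
  intros y0; induction n as [|n [I1 [I2 I3]]]; [simpl; repeat split; lra|].
  cbn [count_levels]; destruct (Rle_dec (INR (S n)) y) as [l|l].
  - rewrite chi_true by auto; rewrite S_INR in *.
    rewrite I1 by lra; (repeat split); lra.
  - rewrite chi_false by auto; rewrite S_INR in *; repeat split; intros; lra.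
Qed.

Definition level (F : (X -> X) -> R) (N k : nat) (h : X -> X) : Prop :=
  Gam h /\ INR k <= INR N * F h.
Fixpoint levels (z : R) (F : (X -> X) -> R) (N n : nat) :
  list (R * ((X -> X) -> Prop)) :=
  match n with O => nil | S k => (z, level F N n) :: levels z F N k end.

Lemma weighted_sum_app L L' h :
  weighted_sum (L ++ L') h = weighted_sum L h + weighted_sum L' h.
Proof. induction L as [|u L IHL]; simpl; [|rewrite IHL]; lra. Qed.

Lemma weighted_mean_app S L L' :
  weighted_mean S (L ++ L') = weighted_mean S L + weighted_mean S L'.
Proof. induction L as [|u L IHL]; simpl; [|rewrite IHL]; lra. Qed.

Lemma weighted_sum_levels z F N n h : Gam h ->
  weighted_sum (levels z F N n) h = z * count_levels n (INR N * F h).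
Proof.
  intros Gh; induction n as [|n IHn]; [simpl; lra|].
  cbn [levels count_levels]; simpl weighted_sum; rewrite IHn.
  rewrite (chi_iff (level F N (S n) h) (INR (S n) <= INR N * F h))
    by (unfold level; tauto).
  simpl; lra.
Qed.

Lemma weighted_mean_levels z F N n :
  weighted_mean Gam (levels z F N n) = z * weighted_mean Gam (levels 1 F N n).
Proof. induction n as [|n IHn]; simpl; [|rewrite IHn]; lra. Qed.

(** Left translation by [g] carries the level sets of the translated function onto those of [F]; [k]
    supplies the preimages. *)
Lemma weighted_mean_translate F N n g k : Gam g ->
  (forall h, Gam h -> Gam (fun x => g (h x))) -> (forall h, Gam h -> Gam (fun x => k (h x))) ->
  (forall x, k (g x) = x) -> (forall x, g (k x) = x) ->
  weighted_mean Gam (levels 1 (fun h => F (fun x => g (h x))) N n) =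
  weighted_mean Gam (levels 1 F N n).
Proof.
  intros Gg cg ck kg gk; induction n as [|n IHn]; [easy|].
  cbn [levels]; simpl weighted_mean; rewrite IHn; f_equal; f_equal.
  rewrite <- (m_inv g) by (auto; intros h [Gh _]; auto).
  apply mean_ext; intros u; unfold level; split.
  - intros [h [[Gh [_ Hl]] ->]]; auto.
  - intros [Gu [_ Hl]]; exists (fun x => k (u x)); repeat split; auto.
    + simpl; replace (fun x => g (k (u x))) with u; auto.
      apply functional_extensionality; intros x; auto.
    + apply functional_extensionality; intros x; auto.
Qed.

(** Scaling by 10 and rounding down loses at most 1 per function. The four integrals then add up to
    at most 10, while each pair gives at least 8.9 - 1 - 1.1 = 6.8, so 13.6 would be at most 11. *)
Lemma mean_contradiction (F1 F2 G1 G2 : (X -> X) -> R) (g1 k1 g2 k2 : X -> X) :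
  (forall h, Gam h -> 0 <= F1 h /\ 0 <= F2 h /\ 0 <= G1 h /\ 0 <= G2 h /\
     F1 h + F2 h + G1 h + G2 h <= 1) ->
  Gam g1 -> (forall h, Gam h -> Gam (fun x => g1 (h x))) ->
  (forall h, Gam h -> Gam (fun x => k1 (h x))) ->
  (forall x, k1 (g1 x) = x) -> (forall x, g1 (k1 x) = x) ->
  Gam g2 -> (forall h, Gam h -> Gam (fun x => g2 (h x))) ->
  (forall h, Gam h -> Gam (fun x => k2 (h x))) ->
  (forall x, k2 (g2 x) = x) -> (forall x, g2 (k2 x) = x) ->
  (forall h, Gam h -> 0.89 <= F1 h + 1.1 * G1 (fun x => g1 (h x))) ->
  (forall h, Gam h -> 0.89 <= F2 h + 1.1 * G2 (fun x => g2 (h x))) ->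
  False.
Proof.
  intros bound Gg1 cg1 ck1 kg1 gk1 Gg2 cg2 ck2 kg2 gk2 E1 E2.
  pose (N := 10%nat); pose (I := fun F => weighted_mean Gam (levels 1 F N N)).
  assert (N10 : INR N = 10) by (unfold N; simpl; lra).
  assert (cnt : forall y, 0 <= y <= 1 ->
    10 * y - 1 <= count_levels N (INR N * y) <= 10 * y).
  { intros y Hy; destruct (count_levels_floor N (INR N * y)) as [_ [U L]];
      rewrite N10 in *; lra. }
  assert (total : I F1 + I F2 + I G1 + I G2 <= 10).
  { assert (P := mean_positive (levels (-1) F1 N N ++ levels (-1) F2 N N ++
       levels (-1) G1 N N ++ levels (-1) G2 N N) Gam 10 (fun _ H => H)).
    rewrite !weighted_mean_app, !(weighted_mean_levels (-1)), m_total in P; unfold I.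
    enough (Q : forall h, Gam h -> 0 <= 10 + weighted_sum (levels (-1) F1 N N ++
      levels (-1) F2 N N ++ levels (-1) G1 N N ++ levels (-1) G2 N N) h)
      by (specialize (P Q); lra).
    intros h Gh; rewrite !weighted_sum_app, !weighted_sum_levels by auto.
    destruct (bound h Gh) as [B1 [B2 [B3 [B4 B5]]]].
    pose proof (cnt (F1 h)); pose proof (cnt (F2 h));
    pose proof (cnt (G1 h)); pose proof (cnt (G2 h)); lra. }
  assert (pair : forall F G g k, (forall h, Gam h -> 0 <= F h <= 1 /\ 0 <= G h <= 1) ->
    Gam g -> (forall h, Gam h -> Gam (fun x => g (h x))) ->
    (forall h, Gam h -> Gam (fun x => k (h x))) ->
    (forall x, k (g x) = x) -> (forall x, g (k x) = x) ->
    (forall h, Gam h -> 0.89 <= F h + 1.1 * G (fun x => g (h x))) ->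
    6.8 <= I F + 1.1 * I G).
  { intros F G g k b Gg cg ck kg gk E; unfold I.
    rewrite <- (weighted_mean_translate G N N g k) by auto.
    assert (P := mean_positive (levels 1 F N N ++ levels 1.1 (fun h => G (fun x => g (h x))) N N)
       Gam (- 6.8) (fun _ H => H)).
    rewrite !weighted_mean_app, !(weighted_mean_levels 1.1), m_total in P.
    enough (Q : forall h, Gam h -> 0 <= - 6.8 + weighted_sum (levels 1 F N N ++
      levels 1.1 (fun h => G (fun x => g (h x))) N N) h)
      by (specialize (P Q); lra).
    intros h Gh; rewrite !weighted_sum_app, !weighted_sum_levels by auto.
    destruct (b h Gh) as [b1 _]; destruct (b _ (cg h Gh)) as [_ b2].
    specialize (E h Gh).
    pose proof (cnt (F h)); pose proof (cnt (G (fun x => g (h x)))); lra. }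
  assert (P1 : 6.8 <= I F1 + 1.1 * I G1).
  { apply (pair F1 G1 g1 k1); auto; intros h Gh; specialize (bound h Gh); lra. }
  assert (P2 : 6.8 <= I F2 + 1.1 * I G2).
  { apply (pair F2 G2 g2 k2); auto; intros h Gh; specialize (bound h Gh); lra. }
  assert (nonneg : forall F, 0 <= I F).
  { intros F; unfold I; generalize N at 2; intros n.
    induction n as [|n IHn]; simpl; [lra|].
    assert (0 <= m (fun h => Gam h /\ level F N (S n) h)) by (apply m_pos; tauto).
    lra. }
  pose proof (nonneg F1); pose proof (nonneg F2); lra.
Qed.
End Mean.

(** * Germs and their mass *)

(** Pieces are half-open because a right germ stays constant from a breakpoint up to, but excluding,
    the next one. *)
Inductive step (phi : R -> R) : R -> R -> Prop :=
| step_const p q c : p <= q -> (forall z, p <= z < q -> phi z = c) -> step phi p q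
| step_cat p r q : step phi p r -> step phi r q -> step phi p q.

Lemma step_le phi p q : step phi p q -> p <= q.
Proof. induction 1; lra. Qed.

Lemma step_of_breaks (phi : R -> R) (B : list R) : forall p q, p <= q ->
  (forall u v, p <= u -> u < v -> v <= q -> (forall b, In b B -> ~ u < b < v) ->
     exists c, forall z, u <= z < v -> phi z = c) -> step phi p q.
Proof.
  induction B as [|b B IHB]; intros p q pq H.
  - destruct (Rle_lt_or_eq_dec p q pq) as [L|<-].
    + destruct (H p q ltac:(lra) L ltac:(lra) ltac:(now intros b [])) as [c Hc].
      now apply step_const with c.
    + apply step_const with 0; [lra|]; intros z ?; lra.
  - destruct (classic (p < b < q)) as [I|O].
    + apply step_cat with b; apply IHB; try lra; intros u v pu uv vq Hno.
      * apply H; try lra; intros b' [<-|I']; [lra|auto].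
      * apply H; try lra; intros b' [<-|I']; [lra|auto].
    + apply IHB; auto; intros u v pu uv vq Hno; apply H; auto.
      intros b' [<-|I'] ?; [apply O; lra|now apply (Hno b')].
Qed.

Lemma is_RInt_const_on (phi : R -> R) p q c : p <= q ->
  (forall z, p <= z < q -> phi z = c) -> is_RInt phi p q ((q - p) * c).
Proof.
  intros pq H; apply is_RInt_ext with (fun _ => c).
  - intros x; rewrite Rmin_left, Rmax_right by auto; intros I; rewrite H; auto; lra.
  - apply (is_RInt_const p q c).
Qed.

Lemma step_ex_RInt phi p q : step phi p q -> ex_RInt phi p q.
Proof.
  induction 1 as [p q c pq H|p r q _ I1 _ I2].
  - eexists; now apply is_RInt_const_on with (c := c).
  - now apply ex_RInt_Chasles with r.
Qed.

(** A change of variables without derivatives: each constant piece of [phi] is carried by [mu] to an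
    interval at most [C] times as long. *)
Lemma RInt_change_le (phi lam mu : R -> R) (C : R) u v : step phi u v ->
  (forall z, 0 <= phi z) ->
  (forall x y, u <= x -> x <= y -> y <= v ->
     mu x <= mu y /\ mu y - mu x <= C * (y - x) /\
     forall z, mu x <= z < mu y -> x <= lam z < y) ->
  exists I, is_RInt (fun z => phi (lam z)) (mu u) (mu v) I /\ I <= C * RInt phi u v.
Proof.
  intros S pos; induction S as [p q c pq H|p r q S1 I1 S2 I2]; intros Hmu.
  - exists ((mu q - mu p) * c).
    destruct (Hmu p q) as [M1 [M2 M3]]; try lra; split.
    + apply is_RInt_const_on; auto.
    + rewrite (is_RInt_unique _ _ _ _ (is_RInt_const_on phi p q c pq H)).
      destruct (Rle_lt_or_eq_dec p q pq) as [L|<-].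
      * assert (0 <= c) by (rewrite <- (H p); [auto|lra]); nra.
      * replace (mu p - mu p) with 0 by ring; lra.
  - pose proof (step_le _ _ _ S1); pose proof (step_le _ _ _ S2).
    destruct I1 as [J1 [R1 L1]]; [intros; apply Hmu; lra|].
    destruct I2 as [J2 [R2 L2]]; [intros; apply Hmu; lra|].
    exists (J1 + J2); split.
    + exact (is_RInt_Chasles _ _ _ _ _ _ R1 R2).
    + rewrite <- (RInt_Chasles phi p r q) by now apply step_ex_RInt.
      unfold plus; simpl; lra.
Qed.

Section Germs.
Variable A : R -> Prop.
Hypothesis hA : is_subring A.

Definition moebius_map (f : P1 -> P1) : Prop := exists m, SL2 A m /\ f = mob m.

(* [f] is the right germ at [x] of the inverse of [h]. *)
Definition inv_germ (h : P1 -> P1) (x : R) (f : P1 -> P1) : Prop :=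
  moebius_map f /\
  exists delta, 0 < delta /\ forall z, x <= z <= x + delta -> h (f (Some z)) = Some z.

(** Real fixed points are roots of a polynomial of degree at most 2, so three of them make all its
    coefficients vanish. *)
Lemma mob_three_fixed m x y z : det m = 1 -> x < y -> y < z ->
  mob m (Some x) = Some x -> mob m (Some y) = Some y -> mob m (Some z) = Some z ->
  forall p, mob m p = p.
Proof.
  intros D xy yz Fx Fy Fz.
  assert (F : forall t, mob m (Some t) = Some t ->
    mc m * t * t + (md m - ma m) * t - mb m = 0).
  { intros t Ft; destruct (mob_coords m (Some t) D) as [k [k0 [E1 E2]]].
    rewrite Ft in E1, E2; simpl in *; nra. }
  apply F in Fx; apply F in Fy; apply F in Fz; clear F.
  assert (G1 : (y - x) * (mc m * (x + y) + (md m - ma m)) = 0) by lra.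
  assert (G2 : (z - y) * (mc m * (y + z) + (md m - ma m)) = 0) by lra.
  apply Rmult_integral in G1; apply Rmult_integral in G2.
  assert (c0 : mc m * (z - x) = 0) by lra.
  apply Rmult_integral in c0; destruct c0 as [c0|c0]; [|lra].
  rewrite c0 in *; assert (da : md m = ma m) by lra.
  assert (b0 : mb m = 0) by (rewrite da in *; lra).
  unfold det in D; rewrite c0, da, b0 in D.
  intros [t|]; simpl; rewrite ?c0, ?da, ?b0.
  - destruct (Req_EM_T (0 * t + ma m) 0); [nra|f_equal; field; nra].
  - destruct (Req_EM_T 0 0); [easy|lra].
Qed.

(** By injectivity of [h] both maps agree on an interval to the right of [x], so their quotient
    fixes three points there. *)
Lemma inv_germ_unique h x f f' : (forall p q, h p = h q -> p = q) ->
  inv_germ h x f -> inv_germ h x f' -> f = f'.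
Proof.
  intros inj [[m [Sm ->]] [d [d0 H]]] [[m' [Sm' ->]] [d' [d0' H']]].
  pose proof (SL2_det _ _ Sm) as D; pose proof (SL2_det _ _ Sm') as D'.
  pose proof (SL2_det _ _ (SL2_minv _ _ hA Sm')) as Di.
  set (e := Rmin d d').
  assert (e0 : 0 < e) by now apply Rmin_glb_lt.
  assert (ed : e <= d) by apply Rmin_l; assert (ed' : e <= d') by apply Rmin_r.
  assert (F : forall z, x <= z <= x + e -> mob (mmul (minv m') m) (Some z) = Some z).
  { intros z Hz; rewrite mob_mmul by auto.
    replace (mob m (Some z)) with (mob m' (Some z)) by (apply inj; rewrite H, H'; auto; lra).
    now apply mob_minv_l. }
  apply functional_extensionality; intros p.
  assert (E : mob (mmul (minv m') m) p = p).
  { apply (mob_three_fixed _ x (x + e / 2) (x + e)); try (apply F); try lra.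
    rewrite det_mmul, D, Di; ring. }
  rewrite mob_mmul in E by auto.
  now rewrite <- (mob_minv_r m' (mob m p)), E.
Qed.

Lemma breaks_gap (B : list R) x : exists y, x < y /\ forall b, In b B -> ~ x < b < y.
Proof.
  induction B as [|b B [y [xy Hy]]]; [exists (x + 1); split; [lra|now intros b []]|].
  destruct (Rlt_dec x b) as [L|L].
  - exists (Rmin y b); split; [now apply Rmin_glb_lt|].
    pose proof (Rmin_l y b); pose proof (Rmin_r y b).
    intros b' [<-|I] ?; [lra|apply (Hy b' I); lra].
  - exists y; split; auto; intros b' [<-|I] ?; [lra|now apply (Hy b' I)].
Qed.

Lemma inv_germ_pieces h : inH_A A h -> exists B : list R,
  forall x y, x < y -> (forall b, In b B -> ~ x < b < y) ->
  exists f, forall z, x <= z < y -> inv_germ h z f.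
Proof.
  intros Hh; destruct (inverse_pieces A hA h Hh) as [B HB]; exists B.
  intros x y xy Hno; destruct (HB x y xy Hno) as [m [Sm Hm]].
  exists (mob m); intros z Hz; split; [now exists m|].
  exists (y - z); split; [lra|]; intros t Ht; apply Hm; lra.
Qed.

Lemma inv_germ_ex h x : inH_A A h -> exists f, inv_germ h x f.
Proof.
  intros Hh; destruct (inv_germ_pieces h Hh) as [B HB].
  destruct (breaks_gap B x) as [y [xy Hy]].
  destruct (HB x y xy Hy) as [f Hf]; exists f; apply Hf; lra.
Qed.

Lemma inH_A_inj h : inH_A A h -> forall p q, h p = h q -> p = q.
Proof. intros [[[k [kh _]] _] _] p q E; rewrite <- (kh p), E; apply kh. Qed.

Definition germ_in (W : (P1 -> P1) -> Prop) (h : P1 -> P1) (x : R) : R :=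
  chi (exists f, inv_germ h x f /\ W f).

Lemma germ_in_eq W h x f : inH_A A h -> inv_germ h x f -> germ_in W h x = chi (W f).
Proof.
  intros Hh Hf; apply chi_iff; split; [|now exists f].
  intros [f' [Hf' Wf']].
  now rewrite (inv_germ_unique h x f f' (inH_A_inj h Hh) Hf Hf').
Qed.

Lemma germ_in_step W h p q : inH_A A h -> p <= q -> step (germ_in W h) p q.
Proof.
  intros Hh pq; destruct (inv_germ_pieces h Hh) as [B HB].
  apply (step_of_breaks _ B); auto; intros u v _ uv _ Hno.
  destruct (HB u v uv Hno) as [f Hf]; exists (chi (W f)); intros z Hz.
  now apply germ_in_eq; [|apply Hf].
Qed.

Definition germ_mass (W : (P1 -> P1) -> Prop) (h : P1 -> P1) : R :=
  RInt (germ_in W h) 0 1.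

Lemma germ_mass_ge0 W h : inH_A A h -> 0 <= germ_mass W h.
Proof.
  intros Hh; apply RInt_ge_0; [lra| |intros; apply chi_bound].
  now apply step_ex_RInt, germ_in_step; [|lra].
Qed.

Lemma germ_mass_disjoint W1 W2 W3 W4 h : inH_A A h ->
  (forall f, moebius_map f -> chi (W1 f) + chi (W2 f) + chi (W3 f) + chi (W4 f) <= 1) ->
  germ_mass W1 h + germ_mass W2 h + germ_mass W3 h + germ_mass W4 h <= 1.
Proof.
  intros Hh dis; unfold germ_mass.
  assert (ex : forall W, ex_RInt (germ_in W h) 0 1)
    by (intros W; apply step_ex_RInt, germ_in_step; auto; lra).
  assert (ex2 : forall f g, ex_RInt f 0 1 -> ex_RInt g 0 1 -> ex_RInt (fun x => f x + g x) 0 1)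
    by (intros f g Ef Eg; exact (ex_RInt_plus f g 0 1 Ef Eg)).
  assert (sum : forall f g, ex_RInt f 0 1 -> ex_RInt g 0 1 ->
    RInt f 0 1 + RInt g 0 1 = RInt (fun x => f x + g x) 0 1)
    by (intros f g Ef Eg; symmetry; exact (RInt_plus f g 0 1 Ef Eg)).
  rewrite !sum by auto.
  apply Rle_trans with (RInt (fun _ => 1) 0 1);
    [|rewrite RInt_const; unfold scal; simpl; unfold mult; simpl; lra].
  apply RInt_le; [lra|auto|apply ex_RInt_const|].
  intros x _; destruct (inv_germ_ex h x Hh) as [f Hf].
  rewrite !(germ_in_eq _ h x f) by auto; apply dis, Hf.
Qed.

(** * Matrices close to the identity and translation of germs *)

Definition near_id (m : mat) : Prop :=
  -0.01 <= ma m - 1 <= 0.01 /\ -0.01 <= mb m <= 0.01 /\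
  -0.01 <= mc m <= 0.01 /\ -0.01 <= md m - 1 <= 0.01.

Lemma near_id_pos m x : near_id m -> -1 <= x <= 2 -> 0.96 <= mc m * x + md m <= 1.04.
Proof. intros [_ [_ [C D]]] I; nra. Qed.

Lemma near_id_minv m : near_id m -> near_id (minv m).
Proof. unfold near_id; simpl; lra. Qed.

Lemma near_id_lip m x y : det m = 1 -> near_id m -> -1 <= x -> x <= y -> y <= 2 ->
  0 <= moebius m y - moebius m x <= 1.1 * (y - x).
Proof.
  intros D N x1 xy y2.
  pose proof (near_id_pos m x N ltac:(lra)) as Px.
  pose proof (near_id_pos m y N ltac:(lra)) as Py.
  rewrite moebius_sub by (auto; lra).
  set (u := mc m * x + md m) in *; set (v := mc m * y + md m) in *.
  assert (uv : 0.92 <= u * v) by nra.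
  split.
  - apply Rdiv_le_0_compat; lra.
  - apply Rle_div_l; nra.
Qed.

Lemma near_id_ends m : near_id m ->
  -0.05 <= moebius m 0 <= 0.05 /\ 0.95 <= moebius m 1 <= 1.05.
Proof.
  intros [Ha [Hb [Hc Hd]]]; unfold moebius.
  split; (split; [apply -> Rle_div_r|apply <- Rle_div_l]); lra.
Qed.

Lemma near_id_moebius_minv m x : det m = 1 -> near_id m -> 0 <= x <= 1 ->
  moebius (minv m) (moebius m x) = x.
Proof.
  intros D N I.
  pose proof (near_id_pos m x N ltac:(lra)) as Px.
  pose proof (near_id_ends m N).
  pose proof (near_id_lip m 0 x D N ltac:(lra) ltac:(lra) ltac:(lra)).
  pose proof (near_id_pos _ (moebius m x) (near_id_minv m N) ltac:(lra)).
  assert (E := mob_minv_l m (Some x) D).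
  rewrite mob_moebius, mob_moebius in E by lra.
  now injection E.
Qed.

Lemma near_id_moebius_minv' m x : det m = 1 -> near_id m ->
  moebius m 0 <= x <= moebius m 1 ->
  0 <= moebius (minv m) x <= 1 /\ moebius m (moebius (minv m) x) = x.
Proof.
  intros D N I.
  assert (Di : det (minv m) = 1) by now rewrite det_minv.
  pose proof (near_id_minv m N) as Ni.
  pose proof (near_id_ends m N) as Ends.
  assert (R : 0 <= moebius (minv m) x <= 1).
  { pose proof (near_id_moebius_minv m 0 D N ltac:(lra)).
    pose proof (near_id_moebius_minv m 1 D N ltac:(lra)).
    pose proof (near_id_lip (minv m) (moebius m 0) x Di Ni ltac:(lra) ltac:(lra) ltac:(lra)).
    pose proof (near_id_lip (minv m) x (moebius m 1) Di Ni ltac:(lra) ltac:(lra) ltac:(lra)).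
    lra. }
  split; auto.
  pose proof (near_id_pos _ x Ni ltac:(lra)).
  pose proof (near_id_pos m (moebius (minv m) x) N ltac:(lra)).
  assert (E := mob_minv_r m (Some x) D).
  rewrite mob_moebius, mob_moebius in E by lra.
  now injection E.
Qed.

Lemma inv_germ_translate g h m x f : SL2 A m -> near_id m ->
  (forall x, 0 <= x <= 1 -> g (Some x) = mob m (Some x)) ->
  0 <= x < 1 -> inv_germ h x f ->
  inv_germ (fun p => g (h p)) (moebius m x) (fun p => f (mob (minv m) p)).
Proof.
  intros Sm N Hg Hx [[n [Sn ->]] [d [d0 Hd]]].
  pose proof (SL2_det _ _ Sm) as D; pose proof (SL2_minv _ _ hA Sm) as Si.
  pose proof (SL2_det _ _ Si) as Di; pose proof (near_id_minv m N) as Ni.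
  split.
  - exists (mmul n (minv m)); split; [now apply SL2_mmul|].
    apply functional_extensionality; intros p; rewrite mob_mmul; auto.
    now apply (SL2_det A).
  (* The interval of the germ is cut at 1, since [g] is known to agree with [m] only on [0,1]. *)
  - set (y := Rmin (x + d) 1).
    assert (xy : x < y) by (apply Rmin_glb_lt; lra).
    assert (yd : y <= x + d) by apply Rmin_l; assert (y1 : y <= 1) by apply Rmin_r.
    pose proof (near_id_lip m 0 x D N ltac:(lra) ltac:(lra) ltac:(lra)).
    pose proof (near_id_lip m y 1 D N ltac:(lra) ltac:(lra) ltac:(lra)).
    pose proof (near_id_lip m x y D N ltac:(lra) ltac:(lra) ltac:(lra)).
    pose proof (near_id_ends m N).
    assert (L : moebius m x < moebius m y).
    { pose proof (near_id_lip (minv m) (moebius m x) (moebius m y) Di Ni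
        ltac:(lra) ltac:(lra) ltac:(lra)) as L.
      rewrite !near_id_moebius_minv in L by (auto; lra); lra. }
    exists (moebius m y - moebius m x); split; [lra|].
    intros z Hz.
    destruct (near_id_moebius_minv' m z D N ltac:(lra)) as [R E].
    pose proof (near_id_pos _ z Ni ltac:(lra)).
    rewrite mob_moebius by lra.
    assert (R' : x <= moebius (minv m) z <= y).
    { pose proof (near_id_moebius_minv m x D N ltac:(lra)).
      pose proof (near_id_moebius_minv m y D N ltac:(lra)).
      pose proof (near_id_lip (minv m) (moebius m x) z Di Ni ltac:(lra) ltac:(lra) ltac:(lra)).
      pose proof (near_id_lip (minv m) z (moebius m y) Di Ni ltac:(lra) ltac:(lra) ltac:(lra)).
      lra. }
    rewrite Hd by lra; rewrite Hg by lra.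
    pose proof (near_id_pos m (moebius (minv m) z) N ltac:(lra)).
    rewrite mob_moebius, E by lra; auto.
Qed.

(** By [cover], the points with germ in [W] and those whose translated germ is in [W'] fill [0,1].
    Changing variables by [m] costs the factor 1.1, and the image of [0,1] exceeds [0,1] by length
    at most 0.1; this leaves 1 - 0.11 = 0.89. *)
Lemma germ_mass_translate (W W' : (P1 -> P1) -> Prop) g h m :
  SL2 A m -> near_id m -> inH_A A g -> inH_A A h ->
  (forall x, 0 <= x <= 1 -> g (Some x) = mob m (Some x)) ->
  (forall f, moebius_map f -> W f \/ W' (fun p => f (mob (minv m) p))) ->
  0.89 <= germ_mass W h + 1.1 * germ_mass W' (fun p => g (h p)).
Proof.
  intros Sm N Hg Hh Eg cover.
  pose proof (SL2_det _ _ Sm) as D; pose proof (SL2_minv _ _ hA Sm) as Si.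
  pose proof (SL2_det _ _ Si) as Di; pose proof (near_id_minv m N) as Ni.
  pose proof (near_id_ends m N) as Ends.
  set (k := fun p => g (h p)).
  assert (Hk : inH_A A k) by exact (inH_A_comp A hA g h Hg Hh).
  set (phi := germ_in W' k).
  assert (st : forall p q, p <= q -> step phi p q) by (intros; now apply germ_in_step).
  destruct (RInt_change_le phi (moebius m) (moebius (minv m)) 1.1 (moebius m 0) (moebius m 1))
    as [I [HI LI]].
  - apply st; lra.
  - intros z; apply chi_bound.
  - intros x y ux xy yv.
    pose proof (near_id_lip (minv m) x y Di Ni ltac:(lra) ltac:(lra) ltac:(lra)).
    destruct (near_id_moebius_minv' m x D N ltac:(lra)) as [Rx Ex].
    destruct (near_id_moebius_minv' m y D N ltac:(lra)) as [Ry Ey].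
    split; [lra|split; [lra|]]; intros z [z1 z2].
    pose proof (near_id_lip m (moebius (minv m) x) z D N ltac:(lra) ltac:(lra) ltac:(lra)).
    pose proof (near_id_lip m z (moebius (minv m) y) D N ltac:(lra) ltac:(lra) ltac:(lra)).
    rewrite Ex, Ey in *; split; [lra|].
    (* Half-open pieces require a strict inequality; equality would make [z] the excluded right
       end. *)
    destruct (Req_dec (moebius m z) y) as [Ez|]; [|lra].
    rewrite <- Ez, near_id_moebius_minv in z2 by (auto; lra); lra.
  - rewrite !near_id_moebius_minv in HI by (auto; lra).
    assert (E1 : 1 <= germ_mass W h + I).
    { rewrite <- (is_RInt_unique _ _ _ _ HI); unfold germ_mass.
      assert (ex1 : ex_RInt (germ_in W h) 0 1)
        by (apply step_ex_RInt, germ_in_step; auto; lra).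
      assert (ex2 : ex_RInt (fun z => phi (moebius m z)) 0 1) by now exists I.
      rewrite <- (RInt_plus _ _ 0 1 ex1 ex2 : _ = RInt _ 0 1 + RInt _ 0 1).
      apply Rle_trans with (RInt (fun _ => 1) 0 1);
        [rewrite RInt_const; unfold scal; simpl; unfold mult; simpl; lra|].
      apply RInt_le; [lra|apply ex_RInt_const|now apply @ex_RInt_plus|].
      intros x Hx; destruct (inv_germ_ex h x Hh) as [f Hf].
      rewrite (germ_in_eq W h x f) by auto.
      unfold phi; rewrite (germ_in_eq W' k _ _ Hk
        (inv_germ_translate g h m x f Sm N Eg ltac:(lra) Hf)).
      unfold plus; simpl.
      destruct (cover f (proj1 Hf)) as [Wf|Wf].
      - rewrite (chi_true (W f)) by auto.
        pose proof (chi_bound (W' (fun p => f (mob (minv m) p)))); lra.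
      - rewrite (chi_true (W' _)) by auto; pose proof (chi_bound (W f)); lra. }
    assert (E2 : RInt phi (moebius m 0) (moebius m 1) <= germ_mass W' k + 0.1).
    { unfold germ_mass; fold phi.
      assert (ex : forall p q, p <= q -> ex_RInt phi p q) by (intros; now apply step_ex_RInt, st).
      assert (ch : forall p q r, p <= q -> q <= r -> RInt phi p r = RInt phi p q + RInt phi q r)
        by (intros p q r pq qr; symmetry; exact (RInt_Chasles phi p q r (ex p q pq) (ex q r qr))).
      assert (b : forall p q, p <= q -> 0 <= RInt phi p q <= q - p).
      { intros p q pq; split.
        - apply RInt_ge_0; auto; intros; apply chi_bound.
        - apply Rle_trans with (RInt (fun _ => 1) p q);
            [|rewrite RInt_const; unfold scal; simpl; unfold mult; simpl; lra].
          apply RInt_le; auto; [apply ex_RInt_const|intros; apply chi_bound]. }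
      pose proof (ch (-0.05) (moebius m 0) 1.05 ltac:(lra) ltac:(lra)).
      pose proof (ch (moebius m 0) (moebius m 1) 1.05 ltac:(lra) ltac:(lra)).
      pose proof (ch (-0.05) 0 1.05 ltac:(lra) ltac:(lra)).
      pose proof (ch 0 1 1.05 ltac:(lra) ltac:(lra)).
      pose proof (b (-0.05) 0 ltac:(lra)); pose proof (b 1 1.05 ltac:(lra)).
      pose proof (b (-0.05) (moebius m 0) ltac:(lra)).
      pose proof (b (moebius m 1) 1.05 ltac:(lra)).
      lra. }
    lra.
Qed.
End Germs.

(** * Free elements close to the identity *)

(** The product [u(x) v(q) u(-y)] multiplied out. *)
Definition letter_mat (s : R) (l : letter) : mat :=
  let x := s ^ head_exp l in
  let y := s ^ head_exp (linv l) in
  let q := if snd l then s else - s in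
  Mat (1 + x * q) (x - y * (1 + x * q)) q (1 - q * y).

Lemma letter_mat_linv s l : letter_mat s (linv l) = minv (letter_mat s l).
Proof.
  unfold letter_mat, minv; rewrite linvK.
  destruct l as [b []]; simpl; f_equal; ring.
Qed.

Lemma det_letter_mat s l : det (letter_mat s l) = 1.
Proof. unfold det; simpl; ring. Qed.

Lemma subring_pow A s n : is_subring A -> A s -> A (s ^ n).
Proof.
  intros [A0 [A1 [AD [AN AM]]]] As; induction n as [|n IHn]; simpl; auto.
Qed.

Lemma letter_mat_SL2 A s l : is_subring A -> A s -> SL2 A (letter_mat s l).
Proof.
  intros hA As; pose proof (fun n => subring_pow A s n hA As) as P.
  destruct hA as [A0 [A1 [AD [AN AM]]]].
  assert (AB : forall x y, A x -> A y -> A (x - y)) by (intros; apply AD; auto).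
  assert (Aq : A (if snd l then s else - s)) by (destruct (snd l); auto).
  unfold SL2; rewrite det_letter_mat; repeat split; simpl; auto 10.
Qed.

Lemma letter_mat_near_id s l : Rabs s <= 0.001 -> near_id (letter_mat s l).
Proof.
  intros Hs.
  assert (P : forall n, -0.001 <= s ^ S n <= 0.001).
  { intros n; cut (Rabs (s ^ S n) <= 0.001).
    { intros H; apply Rabs_le_between in H; lra. }
    rewrite <- RPow_abs, <- tech_pow_Rmult.
    assert (0 <= Rabs s ^ n <= 1).
    { split; [apply pow_le, Rabs_pos|].
      rewrite <- (pow1 n); apply pow_incr; split; [apply Rabs_pos|lra]. }
    pose proof (Rabs_pos s); nra. }
  assert (Q : forall k, -0.001 <= s ^ head_exp k <= 0.001)
    by (intros [[] []]; apply P).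
  apply Rabs_le_between in Hs.
  pose proof (Q l) as X; pose proof (Q (linv l)) as Y.
  unfold near_id; simpl.
  set (x := s ^ head_exp l) in *; set (y := s ^ head_exp (linv l)) in *.
  assert (Hq : -0.001 <= (if snd l then s else - s) <= 0.001) by (destruct (snd l); lra).
  set (q := if snd l then s else - s) in *.
  assert (-0.001 <= x * q <= 0.001) by nra.
  assert (-0.001 <= q * y <= 0.001) by nra.
  assert (-0.002 <= y * (1 + x * q) <= 0.002) by nra.
  repeat split; lra.
Qed.

Definition word_mat (s : R) (w : list letter) : mat :=
  fold_right (fun l M => mmul (letter_mat s l) M) mat1 w.

Lemma det_word_mat s w : det (word_mat s w) = 1.
Proof.
  induction w as [|l w IHw]; [unfold det; simpl; ring|].
  simpl; rewrite det_mmul, IHw, det_letter_mat; ring.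
Qed.

Lemma word_mat_column s w : mc (word_mat s w) = snd (word_vec s w) /\
  ma (word_mat s w) = fst (word_vec s w) + head_shift s w * snd (word_vec s w).
Proof.
  induction w as [|l w [I1 I2]]; [simpl; split; ring|].
  simpl; rewrite I1, I2; split; ring.
Qed.

Definition letter_act (s : R) (l : letter) (f : P1 -> P1) : P1 -> P1 :=
  fun p => f (mob (minv (letter_mat s l)) p).

Lemma act_word_mat s w f :
  act_word _ (letter_act s) w f = fun p => f (mob (minv (word_mat s w)) p).
Proof.
  induction w as [|l w IHw]; apply functional_extensionality; intros p; simpl.
  - f_equal; replace (minv mat1) with mat1 by (unfold minv, mat1; simpl; f_equal; ring).
    now rewrite mob_mat1.
  - rewrite IHw; unfold letter_act.
    replace (minv (mmul (letter_mat s l) (word_mat s w)))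
      with (mmul (minv (word_mat s w)) (minv (letter_mat s l)))
      by (unfold minv, mmul; simpl; f_equal; ring).
    now rewrite mob_mmul by (rewrite det_minv; auto using det_letter_mat, det_word_mat).
Qed.

(** Cancelling the injective [f] at infinity shows that the inverse word matrix fixes infinity, so
    its lower left entry, [snd (word_vec s w)] up to sign, would vanish. *)
Lemma letter_act_free A s w f : w <> nil -> reduced w ->
  snd (word_vec s w) <> 0 -> moebius_map A f -> act_word _ (letter_act s) w f <> f.
Proof.
  intros nw rw y0 [m [Sm ->]] E; rewrite act_word_mat in E.
  apply (f_equal (fun g => g None)) in E.
  apply (mob_inj m) in E; [|now apply (SL2_det A)].
  simpl in E; destruct (Req_EM_T (- mc (word_mat s w)) 0) as [e|]; [|easy].
  apply y0; rewrite <- (proj1 (word_mat_column s w)); lra.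
Qed.

(** Take the fractional part of a non-integer element. *)
Lemma subring_small A : is_subring A ->
  ~ (forall x : R, A x <-> exists z : Z, x = IZR z) ->
  exists t, A t /\ t <> 0 /\ Rabs t < 1.
Proof.
  intros hA hAZ.
  destruct (classic (exists x, A x /\ ~ exists z : Z, x = IZR z)) as [[x [Ax nz]]|no].
  - exists (x + - IZR (Int_part x)); destruct (base_Int_part x).
    repeat split.
    + apply hA; auto; apply hA; now apply subring_IZR.
    + intros E; apply nz; exists (Int_part x); lra.
    + apply Rabs_lt_between; lra.
  - exfalso; apply hAZ; intros x; split.
    + intros Ax; apply NNPP; intros nz; apply no; now exists x.
    + intros [z ->]; now apply subring_IZR.
Qed.

(** * Contradiction between an invariant mean and the paradoxical sets of germs *)

Theorem theorem1 (A : R -> Prop) (hA : is_subring A)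
  (hAZ : ~ (forall x : R, A x <-> exists z : Z, x = IZR z)) :
  ~ amenable (inH_A A).
Proof.
  destruct (subring_small A hA hAZ) as [t [At [t0 t1]]].
  destruct (@WordPolynomials.word_vec_free t t0 t1) as [N HN].
  destruct (pow_lt_1_zero t t1 0.001 ltac:(lra)) as [M HM].
  (* One exponent large enough both for freeness and for [s] to be below 0.001 in absolute value. *)
  set (n := (N + M)%nat); specialize (HN n ltac:(lia)); specialize (HM n ltac:(lia)).
  pose proof (subring_pow A t n hA At) as As.
  pose proof (pow_nonzero t n t0) as s0; set (s := t ^ n) in *; clearbody s.
  destruct (paradoxical_sets _ (moebius_map A) (letter_act s)) as [W [Wdis Wcov]].
  { intros l f; apply functional_extensionality; intros p; unfold letter_act.
    now rewrite letter_mat_linv, minvK, mob_minv_l by apply det_letter_mat. }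
  { intros l f [m [Sm ->]]; exists (mmul m (minv (letter_mat s l))).
    pose proof (letter_mat_SL2 A s l hA As) as Sl.
    pose proof (SL2_minv _ _ hA Sl) as Si; split; [now apply SL2_mmul|].
    apply functional_extensionality; intros p.
    symmetry; apply mob_mmul; now apply (SL2_det A). }
  { intros w f nw rw; apply letter_act_free; auto. }
  intros [mean [m_total [m_pos [m_add m_inv]]]].
  (* The element follows the inverse letter, so that passing from [h] to [g h] acts on germs by
     [letter_act s (linv l)], as in the covering property [Wcov]. *)
  assert (loc : forall l, exists g k, inH_A A g /\ inH_A A k /\
    (forall x, k (g x) = x) /\ (forall x, g (k x) = x) /\
    forall x, 0 <= x <= 1 -> g (Some x) = mob (letter_mat s (linv l)) (Some x)).
  { intros l; pose proof (letter_mat_near_id s (linv l) ltac:(lra)) as [_ [_ [Hc Hd]]].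
    apply local_element; auto; [now apply letter_mat_SL2| |lra|lra].
    simpl; destruct l as [b []]; simpl; lra. }
  destruct (loc (true, true)) as [g1 [k1 [Hg1 [Hk1 [kg1 [gk1 E1]]]]]].
  destruct (loc (false, true)) as [g2 [k2 [Hg2 [Hk2 [kg2 [gk2 E2]]]]]].
  assert (shrink : forall l g h, inH_A A g -> inH_A A h ->
    (forall x, 0 <= x <= 1 -> g (Some x) = mob (letter_mat s (linv l)) (Some x)) ->
    0.89 <= germ_mass A (W l) h + 1.1 * germ_mass A (W (linv l)) (fun p => g (h p))).
  { intros l g h Hg Hh Eg.
    apply (germ_mass_translate A hA _ _ g h (letter_mat s (linv l)));
      auto using letter_mat_SL2.
    apply letter_mat_near_id; lra. }
  apply (mean_contradiction P1 (inH_A A) mean m_total m_pos m_add m_inv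
    (germ_mass A (W (true, true))) (germ_mass A (W (false, true)))
    (germ_mass A (W (true, false))) (germ_mass A (W (false, false))) g1 k1 g2 k2);
    auto using inH_A_comp.
  intros h Hh; repeat split; try now apply germ_mass_ge0.
  apply germ_mass_disjoint; auto; intros f Mf.
  unfold chi; repeat destruct excluded_middle_informative; try lra; exfalso;
  match goal with
  | H1 : W ?l1 f, H2 : W ?l2 f |- _ =>
      assert (l1 = l2) by (now apply (Wdis l1 l2 f)); discriminate
  end.
Qed.
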